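(* Let $n\ge1$, $0<s<1$, and let $u\in C^{2s+\epsilon,s+\epsilon}_{x,\,t,\,{\rm loc}}(\mathbb{R}^n\times\mathbb{R})$ (for some $\epsilon>0$) be a bounded solution of $$(\partial_t-\Delta)^s u(x,t)=0,\qquad (x,t)\in\mathbb{R}^n\times\mathbb{R}.$$ Then $u$ is constant.
   Context: For $0<s<1$, the fully fractional heat operator is defined pointwise by $$(\partial_t-\Delta)^s u(x,t):=C_{n,s}\int_{-\infty}^{t}\int_{\mathbb{R}^n}\frac{u(x,t)-u(y,\tau)}{(t-\tau)^{\frac n2+1+s}}e^{-\frac{|x-y|^2}{4(t-\tau)}}\,dy\,d\tau,\qquad C_{n,s}=\frac{1}{(4\pi)^{n/2}|\Gamma(-s)|},$$ with the $y$-integral taken in the Cauchy principal value sense. The parabolic Hölder space $C^{2\alpha,\alpha}_{x,t}$: for $0<\alpha\le\frac12$, $|u(x,t)-u(y,\tau)|\le C(|x-y|+|t-\tau|^{1/2})^{2\alpha}$; for $\frac12<\alpha\le1$, $u$ is $\alpha$-Hölder in $t$ uniformly in $x$ and $\nabla_x u$ is $(2\alpha-1)$-Hölder in $x$ uniformly in $t$ and $(\alpha-\frac12)$-Hölder in $t$ uniformly in $x$; for $\alpha>1$, $\partial_t u, D_x^2u\in C^{2\alpha-2,\alpha-1}_{x,t}$; ''loc'' means these hold locally. *)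

(* Defs.v *)
From HB Require Import structures.
From mathcomp Require Import all_boot all_order all_algebra.
From mathcomp Require Import all_classical all_reals all_analysis.
Set Implicit Arguments. Unset Strict Implicit. Unset Printing Implicit Defensive.
Import Order.TTheory GRing.Theory Num.Theory.
Import numFieldNormedType.Exports.
Local Open Scope classical_set_scope.
Local Open Scope ring_scope.

Section FracHeat.
Variable R : realType.

Definition sqnorm n (x : 'rV[R]_n) : R := \sum_(i < n) x 0 i ^+ 2.
Definition enorm n (x : 'rV[R]_n) : R := Num.sqrt (sqnorm x).

Definition vcons n (a : R) (v : 'rV[R]_n) : 'rV[R]_n.+1 :=
  \row_(i < n.+1) (if unlift ord0 i is Some j then v 0 j else a).

Fixpoint Rn_int (n : nat) : ('rV[R]_n -> R) -> R :=
  match n return ('rV[R]_n -> R) -> R with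
  | 0 => fun f => f 0
  | m.+1 => fun f =>
      Rintegral lebesgue_measure setT (fun y : R => Rn_int (fun v => f (vcons y v)))
  end.

(** Gamma function on (0, +oo) and Gamma(-s) for 0 < s < 1
    (via Gamma(-s) = Gamma(1-s) / (-s)). *)
Definition Gamma_pos (a : R) : R :=
  Rintegral lebesgue_measure `]0, +oo[ (fun x => x `^ (a - 1) * expR (- x)).
Definition Gamma_neg (s : R) : R := Gamma_pos (1 - s) / (- s).

Definition C_ns (n : nat) (s : R) : R :=
  1 / ((4 * pi) `^ (n%:R / 2) * `|Gamma_neg s|).

Definition frac_heat_kernel n (s : R) (u : 'rV[R]_n -> R -> R)
    (x : 'rV[R]_n) (t : R) (y : 'rV[R]_n) (tau : R) : R :=
  (u x t - u y tau) / (t - tau) `^ (n%:R / 2 + 1 + s)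
  * expR (- (sqnorm (x - y) / (4 * (t - tau)))).

Definition frac_heat_inner_trunc n s u x t tau (eps : R) : R :=
  Rn_int (fun y : 'rV[R]_n =>
    if eps < enorm (y - x) then frac_heat_kernel s u x t y tau else 0).

Definition frac_heat_inner n s (u : 'rV[R]_n -> R -> R) x t tau : R :=
  lim (frac_heat_inner_trunc s u x t tau eps @[eps --> 0^'+]).

(** [frac_heat_value s u x t L]: the integral defining (d_t - Delta)^s u (x,t)
    converges (principal value in y, improper in tau at tau = t) and equals L. *)
Definition frac_heat_value n (s : R) (u : 'rV[R]_n -> R -> R)
    (x : 'rV[R]_n) (t : R) (L : R) : Prop :=
  (forall tau, tau < t -> cvg (frac_heat_inner_trunc s u x t tau eps @[eps --> 0^'+]))
  /\ (C_ns n s * Rintegral lebesgue_measure `]-oo, t - delta]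
          (fun tau => frac_heat_inner s u x t tau)) @[delta --> 0^'+] --> L.

(** compact neighbourhoods used for "loc" *)
Definition in_box n (r : R) (x : 'rV[R]_n) (t : R) : Prop := `|x| <= r /\ `|t| <= r.

Definition dx n (i : 'I_n) (f : 'rV[R]_n -> R -> R) : 'rV[R]_n -> R -> R :=
  fun x t => 'D_(delta_mx 0 i) (fun y => f y t) x.
Definition dt n (f : 'rV[R]_n -> R -> R) : 'rV[R]_n -> R -> R :=
  fun x t => derive1 (f x) t.

Definition holder_low n (alpha : R) (f : 'rV[R]_n -> R -> R) : Prop :=
  forall r : R, exists C : R, forall x y t tau, in_box r x t -> in_box r y tau ->
    `|f x t - f y tau| <= C * (enorm (x - y) + `|t - tau| `^ (1 / 2)) `^ (2 * alpha).

Definition holder_t n (beta : R) (f : 'rV[R]_n -> R -> R) : Prop :=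
  forall r : R, exists C : R, forall x t tau, in_box r x t -> in_box r x tau ->
    `|f x t - f x tau| <= C * `|t - tau| `^ beta.

Definition holder_x n (beta : R) (f : 'rV[R]_n -> R -> R) : Prop :=
  forall r : R, exists C : R, forall x y t, in_box r x t -> in_box r y t ->
    `|f x t - f y t| <= C * enorm (x - y) `^ beta.

Definition holder_mid n (alpha : R) (f : 'rV[R]_n -> R -> R) : Prop :=
  holder_t alpha f /\
  (forall i x t, derivable (fun y => f y t) x (delta_mx 0 i)) /\
  (forall i : 'I_n, holder_x (2 * alpha - 1) (dx i f) /\
                    holder_t (alpha - 1 / 2) (dx i f)).

(** [par_holder k alpha f]: f in C^{2 alpha, alpha}_{x,t,loc}, unfolding the
    recursive case alpha > 1 k times. *)
Fixpoint par_holder (k : nat) n (alpha : R) (f : 'rV[R]_n -> R -> R) : Prop :=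
  match k with
  | 0 => (0 < alpha <= 1 / 2 /\ holder_low alpha f)
         \/ (1 / 2 < alpha <= 1 /\ holder_mid alpha f)
  | k'.+1 => 1 < alpha /\
      (forall x t, derivable (f x) t 1) /\
      (forall i x t, derivable (fun y => f y t) x (delta_mx 0 i)) /\
      (forall i j x t, derivable (fun y => dx i f y t) x (delta_mx 0 j)) /\
      par_holder k' (alpha - 1) (dt f) /\
      (forall i j : 'I_n, par_holder k' (alpha - 1) (dx j (dx i f)))
  end.

Definition parabolic_holder_loc n (alpha : R) (f : 'rV[R]_n -> R -> R) : Prop :=
  exists k : nat, par_holder k alpha f.

End FracHeat.

(* Main.v *)
Require Import Defs.
From HB Require Import structures.
From mathcomp Require Import all_boot all_order all_algebra.
From mathcomp Require Import all_classical all_reals all_analysis.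
From mathcomp Require Import measurable_realfun ring lra.
Import Order.TTheory GRing.Theory Num.Theory.
Import numFieldNormedType.Exports.
Local Open Scope classical_set_scope.
Local Open Scope ring_scope.
Set Implicit Arguments.
Unset Strict Implicit.
Unset Printing Implicit Defensive.

(** Let w(p) = u(p + q) - u(p) for a fixed space-time shift q, and suppose that
    A = sup w > 0. Adding a small bump 2 eta psi, with
    psi = max(0, 1 - sum_i (2 cosh(y_i - x0_i) - 2) - (r - t0)^2) centred where w
    is within eta of A, makes W = w + 2 eta psi attain its maximum at a point z.
    The equation for w at z, together with the exact action of the heat semigroup
    on exponentials, shows that the nonnegative function D = W(z) - W has mass
    O(eta) for the kernel of the operator restricted to time lags at least 1.
    On the other hand the sums w(p) + w(p + q) + ... + w(p + (N - 1) q) telescope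
    to a difference of values of u, hence are bounded in N, so that for N A large
    D(p) + ... + D(p + (N - 1) q) >= 1 at every p; integrating this against a
    Gaussian bounds the same mass below by a constant independent of eta.
    This contradiction gives u(p + q) <= u(p) for all p and q. That the maximum is
    attained uses the joint continuity of u, which the parabolic Hoelder
    condition provides. *)

(** * Isometries of the line *)

(** The Hoelder condition is only local, so it offers no uniform estimate for translating along a
    maximising sequence of w and passing to a limit; the bump replaces that compactness argument.
    Its cost must be O(eta) over all lags sigma. For sigma < 1 the kernel has mass of order
    sigma^(-1-s), which is not integrable, and bounds on psi alone are too weak; but psi >= 1 - rho
    everywhere, with equality at z, and averaging rho - rho(z) against the heat kernel gains a
    factor sigma, leaving sigma^(-s). For sigma >= 1 the bound 0 <= psi <= 1 is enough. Smallness of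
    D near a single point is no contradiction, since w may stay close to A on a large region; what
    is impossible is that w stays close to A along N successive shifts by q, as u would then grow by
    more than its oscillation. Hence the order of choices: N from A and the bound on the sums, then
    the lower bound c from N, then eta from both. *)

Section lebesgue_isometries.
Variable R : realType.
Notation mu := (@lebesgue_measure R).

(** The push-forward change of variables for nonnegative functions is applied to the positive and
    negative parts separately, which keeps the identity valid for any measurable [f]. *)
Lemma Rintegral_preimage (phi : R -> R) (D : set R) (f : R -> R) :
  measurable_fun setT phi ->
  (forall A : set R, measurable A -> mu (phi @^-1` A) = mu A) ->
  measurable D -> measurable_fun D f ->
  \int[mu]_(y in D) f y = \int[mu]_(x in phi @^-1` D) f (phi x).
Proof.
move=> mphi muphi mD mf; rewrite /Rintegral; congr fine.
have mEf : measurable_fun D (EFin \o f) by exact/measurable_EFinP.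
have pushE (g : R -> \bar R) : measurable_fun D g -> (forall y, (0 <= g y)%E) ->
    (\int[mu]_(y in D) g y = \int[mu]_(x in phi @^-1` D) (g (phi x)))%E.
  move=> mg g0.
  rewrite -(@ge0_integral_pushforward _ _ _ _ _ (phi : measurableTypeR R -> measurableTypeR R))//.
  apply: eq_measure_integral => //= A mA AS; exact/esym/muphi.
rewrite integralE [RHS]integralE.
rewrite (pushE ((EFin \o f)^\+%E))//; last exact: measurable_funepos.
rewrite (pushE ((EFin \o f)^\-%E))//; last exact: measurable_funeneg.
by congr (_ - _)%E; apply: eq_integral => x _; rewrite ?funeposE ?funenegE.
Qed.

Lemma lebesgue_measure_shift (c : R) (A : set R) : measurable A ->
  mu ((fun x => c + x) @^-1` A) = mu A.
Proof.
have mphi : measurable_fun setT (fun x : R => c + x).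
  by apply: measurable_funD => //; exact: measurable_cst.
pose phi : measurableTypeR R -> measurableTypeR R := fun x => c + x.
move=> mA; apply/esym.
apply: (@lebesgue_measure_unique _ (pushforward mu phi)) => //=.
move=> _ [[a b]] _ <-; rewrite /pushforward.
rewrite (_ : phi @^-1` _ = `]a - c, b - c]%classic); last first.
  by apply/seteqP; split => x /=; rewrite !in_itv/= ltrBlDl lerBrDl.
rewrite /= !lebesgue_measure_itv/= !lte_fin ltrD2r; case: ifP => // _.
by rewrite -!EFinD; congr EFin; ring.
Qed.

Lemma lebesgue_measure_reflect (c : R) (A : set R) : measurable A ->
  mu ((fun x => c - x) @^-1` A) = mu A.
Proof.
move=> mA.
rewrite -[RHS](lebesgue_measure_shift c mA) -[RHS](@lebesgue_measureN R)//.
rewrite -[X in measurable X]setTI.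
by apply: (measurable_funD (measurable_cst c) (@measurable_id _ _ setT)).
Qed.

Lemma Rintegral_shift (c : R) (D : set R) (f : R -> R) :
  measurable D -> measurable_fun D f ->
  \int[mu]_(y in D) f y = \int[mu]_(x in (fun x => c + x) @^-1` D) f (c + x).
Proof.
apply: Rintegral_preimage; first exact: measurable_funD.
exact: lebesgue_measure_shift.
Qed.

Lemma Rintegral_reflect (c : R) (D : set R) (f : R -> R) :
  measurable D -> measurable_fun D f ->
  \int[mu]_(y in D) f y = \int[mu]_(x in (fun x => c - x) @^-1` D) f (c - x).
Proof.
apply: Rintegral_preimage; first exact: measurable_funB.
exact: lebesgue_measure_reflect.
Qed.

End lebesgue_isometries.

(** * Gaussian integrals on the line *)

Section gauss1.
Variable R : realType.
Notation mu := (@lebesgue_measure R).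
Variables (a m : R).
Hypothesis a0 : 0 < a.

(** The exponential of rate [a] is a multiple of the normal density of variance 1/(2a), so its
    integral follows from the normalisation of that density. *)
Let sg := Num.sqrt (2 * a)^-1.
Let sg2 : sg ^+ 2 = (2 * a)^-1.
Proof. by rewrite sqr_sqrtr// invr_ge0 mulr_ge0// ltW. Qed.
Let sg0 : sg != 0.
Proof. by rewrite gt_eqF// sqrtr_gt0 invr_gt0 mulr_gt0. Qed.

Let gaussE y : expR (- (a * (y - m) ^+ 2)) = Num.sqrt (pi / a) * normal_pdf m sg y.
Proof.
rewrite normal_pdfE//= /normal_peak /normal_fun sg2.
rewrite (_ : (2 * a)^-1 * pi *+ 2 = pi / a); last by field; rewrite gt_eqF.
rewrite [RHS]mulrA divff ?mul1r; last by rewrite gt_eqF// sqrtr_gt0 divr_gt0// pi_gt0.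
by congr expR; field; rewrite gt_eqF.
Qed.

Lemma gauss1_integrable :
  mu.-integrable setT (EFin \o (fun y => expR (- (a * (y - m) ^+ 2)))).
Proof.
rewrite (_ : EFin \o _ = (fun y => (Num.sqrt (pi / a))%:E * (normal_pdf m sg y)%:E)%E).
  by apply: integrableZl => //; exact: integrable_normal_pdf.
by apply/funext => y /=; rewrite gaussE.
Qed.

Lemma gauss1_integral :
  \int[mu]_y expR (- (a * (y - m) ^+ 2)) = Num.sqrt (pi / a).
Proof.
under eq_Rintegral do rewrite gaussE.
rewrite RintegralZl//; last exact: integrable_normal_pdf.
by rewrite /Rintegral integral_normal_pdf/= mulr1.
Qed.

End gauss1.

(** * Iterated integrals of Gaussian-dominated functions *)

Section iterated_integral.
Variable R : realType.
Notation mu := (@lebesgue_measure R).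

(* Continuity is handled through sequences converging coordinatewise, which is
   stable under the slicing [vcons] that defines [Rn_int]. *)
Definition tends n (v_ : nat -> 'rV[R]_n) (v : 'rV[R]_n) : Prop :=
  forall i, v_ k 0 i @[k --> \oo] --> v 0 i.

Definition seqcont n (f : 'rV[R]_n -> R) : Prop :=
  forall v_ v, tends v_ v -> f (v_ k) @[k --> \oo] --> f v.

(* Exactly the measurability that the iterated integral needs: each successive
   partial integral is a measurable function of its remaining variable. *)
Fixpoint Rn_meas n : ('rV[R]_n -> R) -> Prop :=
  match n return ('rV[R]_n -> R) -> Prop with
  | 0 => fun _ => True
  | m.+1 => fun f =>
      measurable_fun setT (fun y : R => Rn_int (fun v => f (vcons y v)))
      /\ forall y, Rn_meas (fun v => f (vcons y v))
  end.

Lemma Rn_measS n (f : 'rV[R]_n.+1 -> R) : Rn_meas f ->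
  measurable_fun setT (fun y : R => Rn_int (fun v => f (vcons y v))) /\
  forall y, Rn_meas (fun v => f (vcons y v)).
Proof. by []. Qed.

(** The Gaussian factorises over coordinates, so slicing at y keeps the rate and multiplies the
    constant by exp(-a y^2). This drives the inductions on the dimension. *)
Definition gdom n (a C : R) (f : 'rV[R]_n -> R) : Prop :=
  forall v, `|f v| <= C * expR (- (a * sqnorm v)).

(** The constant is hidden but the rate is exposed: functions that are added or compared must share
    a rate, while their constants may differ. *)
Definition Rn_nice n (a : R) (f : 'rV[R]_n -> R) : Prop :=
  Rn_meas f /\ exists C, gdom a C f.

Lemma vcons0E n y (v : 'rV[R]_n) : vcons y v 0 ord0 = y.
Proof. by rewrite mxE unlift_none. Qed.

Lemma vconsSE n y (v : 'rV[R]_n) j : vcons y v 0 (lift ord0 j) = v 0 j.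
Proof. by rewrite mxE liftK. Qed.

Lemma sqnorm_ge0 n (v : 'rV[R]_n) : 0 <= sqnorm v.
Proof. by apply: sumr_ge0 => i _; exact: sqr_ge0. Qed.

Lemma sqnorm_vcons n y (v : 'rV[R]_n) : sqnorm (vcons y v) = y ^+ 2 + sqnorm v.
Proof.
rewrite /sqnorm big_ord_recl vcons0E; congr (_ + _).
by apply: eq_bigr => i _; rewrite vconsSE.
Qed.

Lemma tends_vcons n (y_ : nat -> R) y (v_ : nat -> 'rV[R]_n) v :
  y_ k @[k --> \oo] --> y -> tends v_ v ->
  tends (fun k => vcons (y_ k) (v_ k)) (vcons y v).
Proof.
move=> yy vv i; rewrite !mxE.
under eq_cvg do rewrite mxE.
by case: (unlift ord0 i).
Qed.

Lemma tends_cst n (v : 'rV[R]_n) : tends (fun=> v) v.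
Proof. by move=> i; exact: cvg_cst. Qed.

Lemma tendsD n (v_ w_ : nat -> 'rV[R]_n) v w :
  tends v_ v -> tends w_ w -> tends (fun k => v_ k + w_ k) (v + w).
Proof.
move=> vv ww i; rewrite mxE; under eq_cvg do rewrite mxE.
exact: cvgD (vv i) (ww i).
Qed.

Lemma cvg_sum_ord (T : Type) (F : set_system T) {FF : Filter F} n
    (f : 'I_n -> T -> R) (l : 'I_n -> R) :
  (forall i, f i x @[x --> F] --> l i) ->
  \sum_i f i x @[x --> F] --> \sum_i l i.
Proof.
elim: n f l => [|n IH] f l fl.
  by rewrite big_ord0; under eq_fun do rewrite big_ord0; exact: cvg_cst.
rewrite big_ord_recl; under eq_fun do rewrite big_ord_recl.
by apply: cvgD; [exact: fl|apply: IH => i; exact: fl].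
Qed.

Lemma cvg_sqnorm n (v_ : nat -> 'rV[R]_n) v :
  tends v_ v -> sqnorm (v_ k) @[k --> \oo] --> sqnorm v.
Proof.
move=> vv; rewrite /sqnorm; apply: cvg_sum_ord => i.
by rewrite expr2; under eq_cvg do rewrite expr2; exact: cvgM (vv i) (vv i).
Qed.

Lemma cvg_expR (T : Type) (F : set_system T) {FF : Filter F} (f : T -> R) l :
  f @ F --> l -> expR (f x) @[x --> F] --> expR l.
Proof. by move=> fl; apply: continuous_cvg => //; exact: continuous_expR. Qed.

Lemma gdom_ge0 n (a C : R) (f : 'rV[R]_n -> R) : gdom a C f -> 0 <= C.
Proof.
move=> /(_ 0); rewrite /sqnorm big1 ?mulr0 ?oppr0 ?expR0 ?mulr1.
  by apply: le_trans.
by move=> i _; rewrite mxE expr0n.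
Qed.

Lemma gdom_vcons n (a C : R) (f : 'rV[R]_n.+1 -> R) y : gdom a C f ->
  gdom a (C * expR (- (a * y ^+ 2))) (fun v => f (vcons y v)).
Proof.
move=> fC v; apply: le_trans (fC _) _.
by rewrite sqnorm_vcons -mulrA -expRD mulrDr opprD.
Qed.

Lemma gauss_integrable (a : R) : 0 < a ->
  mu.-integrable setT (EFin \o (fun y => expR (- (a * y ^+ 2)))).
Proof. by move=> a0; have := gauss1_integrable 0 a0; under eq_fun do rewrite subr0. Qed.

Lemma gauss_integral (a : R) : 0 < a ->
  \int[mu]_y expR (- (a * y ^+ 2)) = Num.sqrt (pi / a).
Proof.
by move=> a0; rewrite -(gauss1_integral 0 a0); apply: eq_Rintegral => y _; rewrite subr0.
Qed.

Let cgauss_integrable (a C : R) : 0 < a ->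
  mu.-integrable setT (EFin \o (fun y => C * expR (- (a * y ^+ 2)))).
Proof.
move=> a0; rewrite (_ : EFin \o _ =
  (fun y => C%:E * (EFin \o (fun y => expR (- (a * y ^+ 2)))) y)%E).
  by apply: integrableZl => //; exact: gauss_integrable.
by apply/funext => y /=; rewrite EFinM.
Qed.

Let integrable_of_bound (F : R -> R) (a C : R) : 0 < a ->
  measurable_fun setT F -> (forall y, `|F y| <= C * expR (- (a * y ^+ 2))) ->
  mu.-integrable setT (EFin \o F).
Proof.
move=> a0 mF Fb; apply: le_integrable (cgauss_integrable C a0) => //.
  exact/measurable_EFinP.
by move=> y _ /=; rewrite lee_fin; apply: le_trans (Fb y) _; exact: ler_norm.
Qed.

Lemma Rn_int_bound n (a C : R) (f : 'rV[R]_n -> R) : 0 < a ->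
  Rn_meas f -> gdom a C f -> `|Rn_int f| <= C * Num.sqrt (pi / a) ^+ n.
Proof.
move=> a0; elim: n C f => [|n IH] C f mf fC /=.
  by move: (fC 0); rewrite /sqnorm big_ord0 mulr0 oppr0 expR0.
have [mF ms] := Rn_measS mf.
pose F y := Rn_int (fun v => f (vcons y v)).
have Fb y : `|F y| <= C * Num.sqrt (pi / a) ^+ n * expR (- (a * y ^+ 2)).
  by rewrite mulrAC; apply: IH (ms y) (gdom_vcons y fC).
have iF := integrable_of_bound a0 mF Fb.
apply: le_trans (le_normr_Rintegral _ iF) _ => //.
apply: le_trans (le_Rintegral measurableT _ (cgauss_integrable _ a0) (fun y _ => Fb y)) _.
  by move/integrable_abse: iF.
by rewrite RintegralZl// ?gauss_integral// ?exprSr ?mulrA//; exact: gauss_integrable.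
Qed.

Lemma Rn_slice_integrable n (a C : R) (f : 'rV[R]_n.+1 -> R) : 0 < a ->
  Rn_meas f -> gdom a C f ->
  mu.-integrable setT (EFin \o (fun y => Rn_int (fun v => f (vcons y v)))).
Proof.
move=> a0 mf fC; have [mF ms] := Rn_measS mf.
apply: (@integrable_of_bound _ a (C * Num.sqrt (pi / a) ^+ n)) => // y.
by rewrite mulrAC; apply: Rn_int_bound => //; exact: gdom_vcons.
Qed.

(** Dominated convergence, one variable at a time. Measurability of the limit is proved together
    with the convergence, because the partial integral of [f] is measurable as the limit of the
    partial integrals of [f_]. This also gives access to discontinuous limits such as
    truncations. *)
Lemma Rn_int_cvg n (a C : R) (f_ : nat -> 'rV[R]_n -> R) f : 0 < a ->
  (forall k, Rn_meas (f_ k)) -> (forall k, gdom a C (f_ k)) ->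
  (forall v, f_ k v @[k --> \oo] --> f v) ->
  Rn_meas f /\ Rn_int (f_ k) @[k --> \oo] --> Rn_int f.
Proof.
move=> a0; elim: n C f_ f => [|n IH] C f_ f mf fC ff; first by split => //=; exact: ff.
have sl y : Rn_meas (fun v => f (vcons y v)) /\
    Rn_int (fun v => f_ k (vcons y v)) @[k --> \oo] --> Rn_int (fun v => f (vcons y v)).
  apply: (IH (C * expR (- (a * y ^+ 2)))).
  - by move=> k; case: (Rn_measS (mf k)).
  - by move=> k; exact: gdom_vcons.
  - by move=> v; exact: ff.
have mF : measurable_fun setT (fun y => Rn_int (fun v => f (vcons y v))).
  apply: (measurable_fun_cvg (h := fun k y => Rn_int (fun v => f_ k (vcons y v)))).
    by move=> k; case: (Rn_measS (mf k)).
  by move=> y _; case: (sl y).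
split; first by split => // y; case: (sl y).
pose D := C * Num.sqrt (pi / a) ^+ n.
have [] := @dominated_convergence _ _ _ mu setT measurableT
  (fun k y => (Rn_int (fun v => f_ k (vcons y v)))%:E)
  (fun y => (Rn_int (fun v => f (vcons y v)))%:E)
  (EFin \o (fun y => D * expR (- (a * y ^+ 2)))).
- by move=> k; apply/measurable_EFinP; case: (Rn_measS (mf k)).
- exact/measurable_EFinP.
- apply: aeW => y _; apply: cvg_EFin; first exact: nearW.
  by case: (sl y).
- exact: cgauss_integrable.
- apply: aeW => y k _ /=; rewrite lee_fin /D mulrAC.
  by apply: Rn_int_bound => //; [case: (Rn_measS (mf k))|exact: gdom_vcons].
move=> iF _ cv; apply: fine_cvg; rewrite fineK//.
exact: integrable_fin_num.
Qed.

Lemma seqcont_meas n (a C : R) (f : 'rV[R]_n -> R) : 0 < a ->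
  gdom a C f -> seqcont f -> Rn_meas f.
Proof.
move=> a0; elim: n C f => [//|n IH] C f fC cf.
have ms y : Rn_meas (fun v => f (vcons y v)).
  apply: (IH (C * expR (- (a * y ^+ 2)))); first exact: gdom_vcons.
  by move=> v_ v vv; apply: cf; apply: tends_vcons => //; exact: cvg_cst.
split => //; apply: continuous_measurable_fun => y.
apply/(@cvg_nbhsP _ R^o) => y_ yy.
apply: (proj2 (@Rn_int_cvg n a C (fun k v => f (vcons (y_ k) v)) _ a0 _ _ _)) => //.
(* The factor exp(-a y_k^2) is discarded so that the dominating constant is the same for all k. *)
- move=> k v; apply: le_trans (gdom_vcons (y_ k) fC v) _.
  rewrite ler_wpM2r ?expR_ge0// ler_piMr ?(gdom_ge0 fC)//.
  by rewrite -expR0 ler_expR oppr_le0 mulr_ge0 ?sqr_ge0 ?ltW.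
- by move=> v; apply: cf; apply: tends_vcons => //; exact: tends_cst.
Qed.

Lemma eq_Rn_int n (f g : 'rV[R]_n -> R) : f =1 g -> Rn_int f = Rn_int g.
Proof. by move=> fg; congr Rn_int; exact/funext. Qed.

Lemma Rn_int_ge0 n (f : 'rV[R]_n -> R) : (forall v, 0 <= f v) -> 0 <= Rn_int f.
Proof.
elim: n f => [f f0|n IH f f0] /=; first exact: f0.
by apply: Rintegral_ge0 => y _; exact: IH.
Qed.

Lemma Rn_int_lin n (a c : R) (f g : 'rV[R]_n -> R) : 0 < a ->
  Rn_nice a f -> Rn_nice a g ->
  Rn_nice a (fun v => c * f v + g v) /\
  Rn_int (fun v => c * f v + g v) = c * Rn_int f + Rn_int g.
Proof.
move=> a0 [mf [C fC]] [mg [D gD]].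
have hC : gdom a (`|c| * C + D) (fun v => c * f v + g v).
  move=> v; apply: le_trans (ler_normD _ _) _; rewrite normrM mulrDl lerD//.
  by rewrite -mulrA ler_wpM2l.
suff [m e] : Rn_meas (fun v => c * f v + g v) /\
    Rn_int (fun v => c * f v + g v) = c * Rn_int f + Rn_int g.
  by split => //; split => //; eexists; exact: hC.
elim: n C D f g mf fC mg gD {hC} => [//|n IH] C D f g mf fC mg gD.
have sl y : Rn_meas (fun v => c * f (vcons y v) + g (vcons y v)) /\
    Rn_int (fun v => c * f (vcons y v) + g (vcons y v)) =
    c * Rn_int (fun v => f (vcons y v)) + Rn_int (fun v => g (vcons y v)).
  apply: (IH _ _ (fun v => f (vcons y v)) (fun v => g (vcons y v)) _
    (gdom_vcons y fC) _ (gdom_vcons y gD)).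
    by case: (Rn_measS mf).
  by case: (Rn_measS mg).
have iF := Rn_slice_integrable a0 mf fC.
have iG := Rn_slice_integrable a0 mg gD.
have E : (fun y => Rn_int (fun v => c * f (vcons y v) + g (vcons y v))) =
    (fun y => c * Rn_int (fun v => f (vcons y v)) + Rn_int (fun v => g (vcons y v))).
  by apply/funext => y; case: (sl y).
split; last first.
  rewrite /= E RintegralD//; first by rewrite RintegralZl.
  rewrite (_ : EFin \o _ = (fun y => c%:E *
      (EFin \o (fun y => Rn_int (fun v => f (vcons y v)))) y)%E).
    exact: integrableZl.
  by apply/funext => y /=; rewrite EFinM.
split; last by move=> y; case: (sl y).
rewrite E; apply: measurable_funD; last by case: (Rn_measS mg).
by apply: measurable_funM; [exact: measurable_cst|case: (Rn_measS mf)].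
Qed.

Lemma Rn_int_le n (a : R) (f g : 'rV[R]_n -> R) : 0 < a ->
  Rn_nice a f -> Rn_nice a g -> (forall v, f v <= g v) -> Rn_int f <= Rn_int g.
Proof.
move=> a0 nf ng fg.
have [_ e] := Rn_int_lin (-1) a0 nf ng.
rewrite -subr_ge0 addrC -[- _]mulN1r -e; apply: Rn_int_ge0 => v.
by rewrite mulN1r addrC subr_ge0.
Qed.

Lemma Rn_int_shift n (c : 'rV[R]_n) (f : 'rV[R]_n -> R) :
  Rn_meas f -> Rn_int (fun v => f (c + v)) = Rn_int f.
Proof.
elim: n c f => [c f _|n IH c f /Rn_measS[mF ms]] /=.
  by congr f; apply/rowP => -[].
rewrite [RHS](Rintegral_shift (c 0 ord0))// preimage_setT.
apply: eq_Rintegral => y _.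
rewrite -[RHS](IH (\row_j c 0 (lift ord0 j)))//; apply: eq_Rn_int => v; congr f.
apply/rowP => i; rewrite !mxE; case: unliftP => [j ->|->].
  by rewrite !mxE.
by [].
Qed.

Lemma seqcont_nice n (a C : R) (f : 'rV[R]_n -> R) : 0 < a ->
  gdom a C f -> seqcont f -> Rn_nice a f.
Proof. by move=> a0 fC cf; split; [exact: seqcont_meas fC cf|exists C]. Qed.

Lemma Rn_nice0 n (a : R) : 0 < a -> Rn_nice a (fun _ : 'rV[R]_n => 0 : R).
Proof.
move=> a0; apply: (@seqcont_nice _ _ 0) => //.
  by move=> v; rewrite normr0 mul0r.
by move=> v_ v _; exact: cvg_cst.
Qed.

Lemma Rn_intZ n (a c : R) (f : 'rV[R]_n -> R) : 0 < a -> Rn_nice a f ->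
  Rn_nice a (fun v => c * f v) /\ Rn_int (fun v => c * f v) = c * Rn_int f.
Proof.
move=> a0 nf.
have n0 := @Rn_nice0 n a a0.
(* The bound with constant 0 evaluates the integral of the zero function; scaling is then linearity
   with zero as second summand. *)
have /eqP : `|Rn_int (fun _ : 'rV[R]_n => 0 : R)| == 0.
  have g0 : gdom a 0 (fun _ : 'rV[R]_n => 0 : R) by move=> v; rewrite normr0 mul0r.
  by have := Rn_int_bound a0 n0.1 g0; rewrite mul0r eq_le normr_ge0 andbT.
move/normr0P/eqP => i0.
have := Rn_int_lin c a0 nf n0; rewrite i0 addr0.
by under eq_fun do rewrite addr0.
Qed.

Lemma Rn_niceS n (a b : R) (f : 'rV[R]_n -> R) : b <= a -> Rn_nice a f -> Rn_nice b f.
Proof.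
move=> ba [mf [C fC]]; split => //; exists C => v; apply: le_trans (fC v) _.
rewrite ler_wpM2l ?(gdom_ge0 fC)// ler_expR lerN2.
by rewrite ler_wpM2r ?sqnorm_ge0.
Qed.

(** A Gaussian tilted by a linear exponential. Taking [b] to be plus or minus a unit vector produces
    the exponentials of the bump; taking rate 1/2 makes the tilt a translation by [b]. *)
Definition gexp n (a : R) (b v : 'rV[R]_n) : R :=
  expR (\sum_i b 0 i * v 0 i - a * sqnorm v).

Lemma seqcont_gexp n (a : R) (b : 'rV[R]_n) : seqcont (gexp a b).
Proof.
move=> v_ v vv; apply: cvg_expR; apply: cvgB.
  by apply: cvg_sum_ord => i; apply: cvgM (vv i); exact: cvg_cst.
by apply: cvgM (cvg_sqnorm vv); exact: cvg_cst.
Qed.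

(** Half of the rate is spent on absorbing the linear term: b.v <= (a/2)|v|^2 + |b|^2/(2a), the
    defect being the square of b - a v over 2a. *)
Lemma gexp_dom n (a : R) (b : 'rV[R]_n) : 0 < a ->
  gdom (a / 2) (expR (sqnorm b / (2 * a))) (gexp a b).
Proof.
move=> a0 v; rewrite ger0_norm ?expR_ge0// -expRD ler_expR.
rewrite /sqnorm mulr_suml mulr_sumr -!sumrN -!big_split mulr_sumr -sumrN -big_split/=.
apply: ler_sum => i _; rewrite -subr_ge0.
rewrite (_ : _ - _ = (b 0 i - a * v 0 i) ^+ 2 / (2 * a)); last by field; rewrite gt_eqF.
by rewrite divr_ge0 ?sqr_ge0// mulr_ge0// ltW.
Qed.

Lemma gexp_nice n (a : R) (b : 'rV[R]_n) : 0 < a -> Rn_nice (a / 2) (gexp a b).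
Proof.
move=> a0; apply: seqcont_nice (gexp_dom b a0) (@seqcont_gexp _ _ _).
by rewrite divr_gt0.
Qed.

(** Completing the square in each coordinate. At a = 1/(4 sigma) the last factor is exp(sigma
    |b|^2), the eigenvalue of the heat semigroup on the exponential exp(b.v). *)
Lemma Rn_int_gexp n (a : R) (b : 'rV[R]_n) : 0 < a ->
  Rn_int (gexp a b) = Num.sqrt (pi / a) ^+ n * expR (sqnorm b / (4 * a)).
Proof.
move=> a0; elim: n b => [b|n IH b] /=.
  by rewrite /gexp /sqnorm !big_ord0 mulr0 subr0 mul0r expR0 mulr1.
pose b' : 'rV[R]_n := \row_j b 0 (lift ord0 j).
pose K := Num.sqrt (pi / a) ^+ n * expR (sqnorm b' / (4 * a)) *
  expR (b 0 ord0 ^+ 2 / (4 * a)).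
have sl y : Rn_int (fun v => gexp a b (vcons y v)) =
    K * expR (- (a * (y - b 0 ord0 / (2 * a)) ^+ 2)).
  have -> : (fun v => gexp a b (vcons y v)) =
      (fun v => expR (b 0 ord0 * y - a * y ^+ 2) * gexp a b' v).
    apply/funext => v; rewrite /gexp -expRD; congr expR.
    rewrite sqnorm_vcons big_ord_recl vcons0E.
    under eq_bigr do rewrite vconsSE.
    by under [in RHS]eq_bigr do rewrite mxE; ring.
  have a20 : 0 < a / 2 by rewrite divr_gt0.
  rewrite (proj2 (Rn_intZ _ a20 (gexp_nice _ a0))).
  rewrite IH /K mulrC -!mulrA; congr (_ * (_ * _)).
  by rewrite -expRD; congr expR; field; rewrite gt_eqF.
under eq_Rintegral do rewrite sl.
rewrite RintegralZl//; last exact: gauss1_integrable.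
rewrite gauss1_integral// /K.
rewrite (_ : sqnorm b = b 0 ord0 ^+ 2 + sqnorm b'); last first.
  by rewrite /sqnorm big_ord_recl; congr (_ + _); apply: eq_bigr => i _; rewrite mxE.
by rewrite [X in _ = _ * expR X](mulrDl (b 0 ord0 ^+ 2)) expRD (exprSr _ n); ring.
Qed.

End iterated_integral.

(** * Power integrals *)

Section power_integrals.
Variable R : realType.
Notation mu := (@lebesgue_measure R).

Lemma powR_continuous_pos (p x : R) : 0 < x -> {for x, continuous (fun y => y `^ p)}.
Proof.
move=> x0; apply: differentiable_continuous; apply/derivable1_diffP.
by apply: derivable_powR; rewrite in_itv/= andbT.
Qed.

Lemma powRN_cvgy (p : R) : 0 < p -> x `^ (- p) @[x --> +oo] --> (0 : R).
Proof.
move=> p0; apply/cvgrPdist_le => e e0; near=> x.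
have X0 : 0 < e `^ (- p^-1) by exact: powR_gt0.
have Xx : e `^ (- p^-1) <= x by near: x; exact: nbhs_pinfty_ge.
rewrite sub0r normrN ger0_norm ?powR_ge0// powRN.
rewrite -[leRHS]invrK lef_pV2 ?posrE ?invr_gt0// ?powR_gt0// ?(lt_le_trans X0)//.
apply: le_trans (_ : (e `^ (- p^-1)) `^ p <= _).
  by rewrite -powRrM mulNr mulVf ?gt_eqF// powR_inv1// ltW.
by apply: ge0_ler_powR => //; rewrite ?nnegrE ?ltW// (lt_le_trans X0).
Unshelve. all: by end_near. Qed.

Lemma integral_powR_tail (p a : R) : 0 < p -> 0 < a ->
  (\int[mu]_(x in `[a, +oo[) (x `^ (- (1 + p)))%:E = (a `^ (- p) / p)%:E)%E.
Proof.
move=> p0 a0.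
have dF (x : R) : a <= x ->
    is_derive x 1 (fun y => - p^-1 * y `^ (- p)) (x `^ (- (1 + p))).
  move=> ax; have x0 : 0 < x by exact: lt_le_trans ax.
  have H := is_derive1_powR (- p) x0.
  apply: is_derive_eq (is_deriveZ (- p^-1) H) _.
  rewrite /GRing.scale/= mulrA mulrNN mulVf ?gt_eqF// mul1r.
  by congr (_ `^ _); ring.
rewrite (@ge0_continuous_FTC2y _ _ (fun y => - p^-1 * y `^ (- p)) _ 0).
- by rewrite -EFinB sub0r mulNr opprK mulrC.
- by move=> x _; exact: powR_ge0.
- apply/continuous_within_itvcyP; split.
    by move=> x; rewrite in_itv/= andbT => ax; apply: powR_continuous_pos; exact: lt_trans ax.
  by apply: cvg_at_right_filter; exact: powR_continuous_pos.
- rewrite -[X in _ --> X](mulr0 (- p^-1)); apply: cvgM; first exact: cvg_cst.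
  exact: powRN_cvgy.
- by move=> x ax; apply: ex_derive; apply: dF; exact: ltW.
- apply: cvgM; first exact: cvg_cst.
  by apply: cvg_at_right_filter; exact: powR_continuous_pos.
- by move=> x; rewrite in_itv/= andbT => ax; rewrite derive1E; have [_ ->] := dF x (ltW ax).
Qed.

Lemma integrable_powR_tail (p a : R) : 0 < p -> 0 < a ->
  mu.-integrable `[a, +oo[ (EFin \o (fun x => x `^ (- (1 + p)))).
Proof.
move=> p0 a0; apply/integrableP; split.
  by apply/measurable_EFinP; apply: measurable_funTS; exact: measurable_powR.
under eq_integral do rewrite /= ger0_norm ?powR_ge0//.
by rewrite integral_powR_tail// ltry.
Qed.

Lemma Rintegral_powR_tail (p a : R) : 0 < p -> 0 < a ->
  \int[mu]_(x in `[a, +oo[) (x `^ (- (1 + p))) = a `^ (- p) / p.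
Proof. by move=> p0 a0; rewrite /Rintegral integral_powR_tail. Qed.

Lemma integral_powR_head (p a : R) : p < 1 -> 0 < a < 1 ->
  (\int[mu]_(x in `[a, 1%R]) (x `^ (- p))%:E = ((1 - a `^ (1 - p)) / (1 - p))%:E)%E.
Proof.
move=> p1 /andP[a0 a1].
have q0 : 0 < 1 - p by rewrite subr_gt0.
have dF (x : R) : 0 < x ->
    is_derive x 1 (fun y => (1 - p)^-1 * y `^ (1 - p)) (x `^ (- p)).
  move=> x0; have H := is_derive1_powR (1 - p) x0.
  apply: is_derive_eq (is_deriveZ ((1 - p)^-1) H) _.
  rewrite /GRing.scale/= mulrA mulVf ?gt_eqF// mul1r.
  by congr (_ `^ _); ring.
have cF (x : R) : 0 < x -> {for x, continuous (fun y => (1 - p)^-1 * y `^ (1 - p))}.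
  by move=> x0; apply: cvgM; [exact: cvg_cst|exact: powR_continuous_pos].
rewrite (@continuous_FTC2 _ _ (fun y => (1 - p)^-1 * y `^ (1 - p)))//.
- by rewrite -EFinB powR1; congr EFin; field; rewrite gt_eqF.
- apply: continuous_in_subspaceT => x; rewrite inE/= in_itv/= => /andP[ax _].
  by apply: powR_continuous_pos; exact: lt_le_trans ax.
- split.
  + by move=> x; rewrite in_itv/= => /andP[ax _]; apply: ex_derive; apply: dF; exact: lt_trans ax.
  + by apply: cvg_at_right_filter; exact: cF.
  + by apply: cvg_at_left_filter; exact: cF.
- move=> x; rewrite in_itv/= => /andP[ax _]; rewrite derive1E.
  by have [_ ->] := dF x (lt_trans a0 ax).
Qed.

Lemma Rintegral_powR_head (p a : R) : p < 1 -> 0 < a < 1 ->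
  \int[mu]_(x in `[a, 1]) (x `^ (- p)) <= (1 - p)^-1.
Proof.
move=> p1 a01; rewrite /Rintegral integral_powR_head//=.
by rewrite ler_pdivrMr ?subr_gt0// mulVf ?gt_eqF ?subr_gt0// gerBl powR_ge0.
Qed.

(** A real-valued integral is 0 when the underlying one is infinite, so positivity requires
    finiteness as well. The integrand is below x^(-p) on (0,1], below x^(-1-p) on [1,oo) because
    exp(-x) <= 1/x, and bounded away from 0 on [1,2]. *)
Lemma Gamma_pos_gt0 (p : R) : 0 < p < 1 -> 0 < Gamma_pos (1 - p).
Proof.
move=> /andP[p0 p1].
pose f (x : R) := x `^ (- p) * expR (- x).
have -> : Gamma_pos (1 - p) = \int[mu]_(x in `]0, +oo[) f x.
  apply: eq_Rintegral => x _; rewrite /f; congr (_ `^ _ * _); ring.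
have mf D : measurable_fun D f.
  apply: measurable_funTS; apply: measurable_funM; first exact: measurable_powR.
  apply: measurableT_comp => //; exact: measurable_funN.
have mEf D : measurable_fun D (EFin \o f) by apply/measurable_EFinP; exact: mf.
have f0 x : 0 <= f x by rewrite mulr_ge0 ?powR_ge0 ?expR_ge0.
have b1 : (\int[mu]_(x in `]0%R, 1%R]) (f x)%:E <= ((1 - p)^-1)%:E)%E.
  (* Monotone exhaustion avoids the singularity at 0; starting from 1/2 keeps the left endpoint
     strictly below 1, as [integral_powR_head] demands. *)
  pose F (i : nat) := `[(i.+2%:R^-1 : R), 1%R]%classic.
  have FU : `]0%R, 1%R]%classic = \bigcup_i F i.
    apply/seteqP; split => [x|x [i _]]; rewrite /F /= !in_itv/=.
      move=> /andP[x0 x1]; exists (Num.truncn x^-1) => //=; rewrite in_itv/= x1 andbT.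
      rewrite invf_ple ?posrE// ltW// (@lt_le_trans _ _ (Num.truncn x^-1).+1%:R)//.
        exact: truncnS_gt.
      by rewrite ler_nat.
    by move=> /andP[ix ->]; rewrite andbT (lt_le_trans _ ix)// invr_gt0.
  have cv : (\int[mu]_(x in F i) (f x)%:E @[i --> \oo] -->
      \int[mu]_(x in \bigcup_i F i) (f x)%:E)%E.
    apply: ge0_nondecreasing_set_cvg_integral => //.
    - apply/nondecreasing_seqP => i; rewrite subsetEset => x; rewrite /F /= !in_itv/=.
      move=> /andP[ix ->]; rewrite andbT (le_trans _ ix)// lef_pV2 ?posrE//.
      by rewrite ler_nat.
    - by move=> i; apply: measurable_itv.
    - by move=> i; apply/measurable_EFinP; exact: mf.
    - by move=> i x _; rewrite lee_fin.
  rewrite FU; apply: (cvge_le _ cv); apply: nearW => i.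
  apply: (@le_trans _ _ (\int[mu]_(x in F i) (x `^ (- p))%:E)%E).
    apply: ge0_le_integral => //.
    - exact: measurable_itv.
    - by move=> x _; rewrite lee_fin.
    - apply/measurable_EFinP; exact: mf.
    - by apply/measurable_EFinP; apply: measurable_funTS; exact: measurable_powR.
    - move=> x; rewrite /F /= in_itv/= => /andP[ix _]; rewrite lee_fin ler_piMr ?powR_ge0//.
      by rewrite -expR0 ler_expR oppr_le0 (le_trans _ ix)// invr_ge0.
  rewrite integral_powR_head// ?lee_fin.
    by rewrite ler_pdivrMr ?subr_gt0// mulVf ?gt_eqF ?subr_gt0// gerBl powR_ge0.
  by rewrite invr_gt0 ltr0n/= invf_lt1// ltr1n.
have b2 : (\int[mu]_(x in `]1%R, +oo[) (f x)%:E <= (p^-1)%:E)%E.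
  apply: (@le_trans _ _ (\int[mu]_(x in `[1%R, +oo[) (x `^ (- (1 + p)))%:E)%E).
    apply: (@le_trans _ _ (\int[mu]_(x in `[1%R, +oo[) (f x)%:E)%E).
      apply: ge0_subset_integral => //; first exact: mEf.
        by move=> x _; rewrite lee_fin.
      by apply: subset_itvr; rewrite bnd_simp.
    apply: ge0_le_integral => //.
    - by move=> x _; rewrite lee_fin.
    - apply/measurable_EFinP; exact: mf.
    - by apply/measurable_EFinP; apply: measurable_funTS; exact: measurable_powR.
    - move=> x; rewrite /= in_itv/= andbT => x1; rewrite lee_fin /f.
      have x0 : 0 < x by exact: lt_le_trans x1.
      rewrite opprD powRD; last by rewrite (gt_eqF x0) implybT.
      rewrite mulrC ler_wpM2r ?powR_ge0//.
      rewrite powR_inv1 ?(ltW x0)// expRN lef_pV2 ?posrE ?expR_gt0//.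
      by apply: le_trans (expR_ge1Dx x); rewrite lerDr.
  by rewrite integral_powR_tail// powR1 mul1r.
have E : `]0%R, +oo[%classic = `]0%R, 1%R] `|` `]1%R, +oo[ :> set R.
  apply/seteqP; split => [x|x [|]]; rewrite /= !in_itv/= ?andbT.
  - by move=> x0; case: (leP x 1) => x1; [left|right]; rewrite ?x0.
  - by move=> /andP[].
  - by move=> x1; exact: lt_trans x1.
have fin : (\int[mu]_(x in `]0%R, +oo[) (f x)%:E < +oo)%E.
  rewrite E ge0_integral_setU//.
  - by apply: (@le_lt_trans _ _ ((1 - p)^-1%:E + p^-1%:E)%E); [exact: leeD|rewrite -EFinD ltry].
  - apply/measurable_EFinP; exact: mf.
  - by move=> x _; rewrite lee_fin.
  - rewrite disj_set2E; apply/eqP/seteqP; split => // x [] /=; rewrite !in_itv/= andbT.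
    by move=> /andP[_]; rewrite leNgt => /negP.
apply: fine_gt0; rewrite fin andbT.
apply: (@lt_le_trans _ _ (\int[mu]_(x in `[1%R, 2%R]) (2 `^ (- p) * expR (- 2))%:E)%E).
  rewrite integral_cst//= lebesgue_measure_itv/= lte_fin ltr1n.
  by rewrite -EFinB -EFinM lte_fin !mulr_gt0 ?expR_gt0 ?powR_gt0// subr_gt0 ltr1n.
apply: (@le_trans _ _ (\int[mu]_(x in `[1%R, 2%R]) (f x)%:E)%E).
  apply: ge0_le_integral => //.
  - apply/measurable_EFinP; exact: mf.
  - move=> x; rewrite /= in_itv/= => /andP[x1 x2]; rewrite lee_fin /f.
    have x0 : 0 < x by exact: lt_le_trans x1.
    rewrite ler_pM ?powR_ge0 ?expR_ge0 ?ler_expR ?lerN2//.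
    rewrite !powRN lef_pV2 ?posrE ?powR_gt0//.
    by apply: ge0_ler_powR; rewrite ?nnegrE// ltW.
apply: ge0_subset_integral => //; first exact: mEf.
  by move=> x _; rewrite lee_fin.
by move=> x; rewrite /= !in_itv/= andbT => /andP[x1 _]; exact: lt_le_trans x1.
Qed.

Lemma C_ns_gt0 (n : nat) (p : R) : 0 < p < 1 -> 0 < C_ns n p.
Proof.
move=> p01; rewrite /C_ns divr_gt0// mulr_gt0//.
  by rewrite powR_gt0// mulr_gt0// pi_gt0.
rewrite normr_gt0 /Gamma_neg; apply: mulf_neq0.
  by rewrite gt_eqF// Gamma_pos_gt0.
by rewrite invr_eq0 oppr_eq0 gt_eqF//; case/andP: p01.
Qed.

End power_integrals.

(** * Spatial integrals against the kernel at a fixed time lag *)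

Section heat_integral.
Variable R : realType.
Notation mu := (@lebesgue_measure R).

Definition jcont n (f : 'rV[R]_n -> R -> R) : Prop :=
  forall x_ x t_ t, tends x_ x -> t_ k @[k --> \oo] --> t ->
    f (x_ k) (t_ k) @[k --> \oo] --> f x t.

(* The kernel of the operator at time lag [sigma], centred at the origin. *)
Definition hk n (s sigma : R) (v : 'rV[R]_n) : R :=
  (sigma `^ (n%:R / 2 + 1 + s))^-1 * expR (- (sqnorm v / (4 * sigma))).

Definition hint n (s : R) (G : 'rV[R]_n -> R -> R) (sigma : R) : R :=
  Rn_int (fun v => G v sigma * hk s sigma v).

Lemma hk_ge0 n (s sigma : R) (v : 'rV[R]_n) : 0 <= hk s sigma v.
Proof. by rewrite mulr_ge0 ?expR_ge0 ?invr_ge0 ?powR_ge0. Qed.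

Lemma hk_gexp n (s sigma : R) (v : 'rV[R]_n) :
  hk s sigma v = (sigma `^ (n%:R / 2 + 1 + s))^-1 * gexp (4 * sigma)^-1 0 v.
Proof.
rewrite /hk /gexp big1 ?sub0r => [|i _]; last by rewrite mxE mul0r.
by rewrite [sqnorm v / _]mulrC.
Qed.

Lemma hk_rate_gt0 (sigma : R) : 0 < sigma -> 0 < (4 * sigma)^-1 / 2.
Proof. by move=> s0; rewrite divr_gt0// invr_gt0 mulr_gt0. Qed.

Lemma seqcont_hk n (s sigma : R) : seqcont (@hk n s sigma).
Proof.
move=> v_ v vv; apply: cvgM; first exact: cvg_cst.
by apply: cvg_expR; apply: cvgN; apply: cvgM (cvg_sqnorm vv) (cvg_cst _).
Qed.

(** The rate is half that of the kernel, to agree with [gexp_nice]: all integrands at one lag can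
    then be combined and compared. *)
Lemma hk_nice n (s sigma B : R) (g : 'rV[R]_n -> R) : 0 < sigma ->
  (forall v, `|g v| <= B) -> seqcont g ->
  Rn_nice ((4 * sigma)^-1 / 2) (fun v => g v * hk s sigma v).
Proof.
move=> s0 gB cg.
apply: (@seqcont_nice _ _ _ (B * (sigma `^ (n%:R / 2 + 1 + s))^-1)).
- exact: hk_rate_gt0.
- move=> v; rewrite normrM [`|hk _ _ _|]ger0_norm ?hk_ge0// -mulrA.
  apply: ler_pM => //; first exact: hk_ge0.
  rewrite ler_wpM2l ?invr_ge0 ?powR_ge0// ler_expR lerN2 [leRHS]mulrC.
  rewrite ler_wpM2r ?sqnorm_ge0// ler_piMr ?invr_ge0 ?mulr_ge0 ?ltW//.
  by rewrite invf_lt1// ltr1n.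
- by move=> v_ v vv; apply: cvgM (cg _ _ vv) (seqcont_hk vv).
Qed.

(** The Gaussian mass (4 pi sigma)^(n/2) cancels the dimensional part of the power. What remains is
    integrable at infinity but not at 0, hence the separate treatment of lags below and above 1. *)
Lemma Rn_int_hk n (s sigma : R) : 0 < sigma ->
  Rn_int (@hk n s sigma) = Num.sqrt (4 * pi) ^+ n * sigma `^ (- (1 + s)).
Proof.
move=> s0; have a0 : 0 < (4 * sigma)^-1 by rewrite invr_gt0 mulr_gt0.
have -> : @hk n s sigma =
    (fun v => (sigma `^ (n%:R / 2 + 1 + s))^-1 * gexp (4 * sigma)^-1 0 v).
  by apply/funext => v; exact: hk_gexp.
rewrite (proj2 (Rn_intZ _ (hk_rate_gt0 s0) (gexp_nice _ a0))) Rn_int_gexp//.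
have -> : sqnorm (0 : 'rV[R]_n) = 0 by rewrite /sqnorm big1// => i _; rewrite mxE expr0n.
rewrite mul0r expR0 mulr1 invrK mulrA [pi * 4]mulrC sqrtrM ?mulr_ge0 ?pi_ge0// exprMn.
rewrite mulrCA; congr (_ * _).
rewrite -powR12_sqrt ?(ltW s0)// -powR_mulrn ?powR_ge0// -powRrM -powRN -powRD.
  by congr (_ `^ _); field.
by rewrite (gt_eqF s0) implybT.
Qed.

Section hint_theory.
Variables (n : nat) (s : R).
Implicit Types (G H : 'rV[R]_n -> R -> R) (B C c d sigma t : R).

Lemma jcont_slice G t : jcont G -> seqcont (fun v => G v t).
Proof. by move=> cG v_ v vv; apply: cG => //; exact: cvg_cst. Qed.

Lemma hint_nice G B sigma : 0 < sigma -> jcont G -> (forall v t, `|G v t| <= B) ->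
  Rn_nice ((4 * sigma)^-1 / 2) (fun v => G v sigma * hk s sigma v).
Proof.
by move=> s0 cG GB; apply: (@hk_nice _ _ _ B) => //; exact: jcont_slice.
Qed.

Lemma hint_le G H B C sigma : 0 < sigma -> jcont G -> jcont H ->
  (forall v t, `|G v t| <= B) -> (forall v t, `|H v t| <= C) ->
  (forall v, G v sigma <= H v sigma) -> hint s G sigma <= hint s H sigma.
Proof.
move=> s0 cG cH GB HC GH.
apply: (Rn_int_le (hk_rate_gt0 s0) (hint_nice s0 cG GB) (hint_nice s0 cH HC)) => v.
by rewrite ler_wpM2r ?hk_ge0.
Qed.

Lemma hint_lin c G H B C sigma : 0 < sigma -> jcont G -> jcont H ->
  (forall v t, `|G v t| <= B) -> (forall v t, `|H v t| <= C) ->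
  hint s (fun v t => c * G v t + H v t) sigma = c * hint s G sigma + hint s H sigma.
Proof.
move=> s0 cG cH GB HC.
rewrite -(proj2 (Rn_int_lin c (hk_rate_gt0 s0) (hint_nice s0 cG GB) (hint_nice s0 cH HC))).
by apply: eq_Rn_int => v; ring.
Qed.

Lemma hint_cst c sigma : 0 < sigma ->
  hint s (fun (_ : 'rV[R]_n) _ => c) sigma =
  c * (Num.sqrt (4 * pi) ^+ n * sigma `^ (- (1 + s))).
Proof.
move=> s0; rewrite -Rn_int_hk// /hint.
suff H : Rn_nice ((4 * sigma)^-1 / 2) (@hk n s sigma).
  by rewrite (proj2 (Rn_intZ _ (hk_rate_gt0 s0) H)).
rewrite (_ : hk s sigma = (fun v => 1 * hk s sigma v)); last first.
  by apply/funext => v; rewrite mul1r.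
apply: (@hk_nice _ _ _ 1 (fun=> 1)) => //; first by move=> v; rewrite normr1.
by move=> v_ v _; exact: cvg_cst.
Qed.

Lemma jcont_cst c : jcont (fun (_ : 'rV[R]_n) _ => c).
Proof. by move=> x_ x t_ t _ _; exact: cvg_cst. Qed.

Lemma hint_bound G B sigma : 0 < sigma -> jcont G -> (forall v t, `|G v t| <= B) ->
  `|hint s G sigma| <= B * (Num.sqrt (4 * pi) ^+ n * sigma `^ (- (1 + s))).
Proof.
move=> s0 cG GB; rewrite ler_norml; apply/andP; split.
  rewrite -mulNr -hint_cst//; apply: (@hint_le _ _ `|- B| B) => //.
  - exact: jcont_cst.
  - by move=> v; have := GB v sigma; rewrite ler_norml => /andP[].
rewrite -hint_cst//; apply: (@hint_le _ _ B `|B|) => //.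
- exact: jcont_cst.
- by move=> v; have := GB v sigma; rewrite ler_norml => /andP[].
Qed.

Lemma hint_continuous G B sigma : 0 < sigma -> jcont G ->
  (forall v t, `|G v t| <= B) -> {for sigma, continuous (hint s G)}.
Proof.
move=> s0 cG GB; apply/(@cvg_nbhsP _ R^o) => t_ tt.
have B0 : 0 <= B by apply: le_trans (GB 0 0).
(* The convergence theorem wants its bounds for every index, so the sequence is shifted until it
   lies in (sigma/2, 2 sigma); there every kernel has rate at least 1/(8 sigma). *)
have [N _ tN] : \forall k \near \oo, sigma / 2 < t_ k < 2 * sigma.
  near=> k; apply/andP; split; near: k.
    by apply: (cvgr_gt _ tt); rewrite ltr_pdivrMr// ltr_pMr// ltr1n.
  by apply: (cvgr_lt _ tt); rewrite ltr_pMl// ltr1n.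
have tN' k : sigma / 2 < t_ (k + N)%N < 2 * sigma by apply: tN => /=; rewrite leq_addl.
rewrite -(cvg_shiftn N).
have tpos k : 0 < t_ (k + N)%N.
  by have /andP[+ _] := tN' k; apply: le_lt_trans; rewrite divr_ge0// ltW.
have ttN : t_ (k + N)%N @[k --> \oo] --> sigma by rewrite cvg_shiftn.
have a0 : 0 < (8 * sigma)^-1 by rewrite invr_gt0 mulr_gt0.
pose p := n%:R / 2 + 1 + s.
have cp : ((t_ (k + N)%N) `^ p)^-1 @[k --> \oo] --> (sigma `^ p)^-1.
  apply: cvgV; first by rewrite gt_eqF ?powR_gt0.
  apply: (@continuous_cvg _ _ _ _ _ _ (fun y => y `^ p)) ttN.
  exact: powR_continuous_pos.
have [K K0 HK] : exists2 K, 0 <= K & forall k, ((t_ (k + N)%N) `^ p)^-1 <= K.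
  have [M [_ HM]] := cvg_seq_bounded (cvgP _ cp).
  have {}HM k : `|((t_ (k + N)%N) `^ p)^-1| <= M + 1 by apply: HM => //; rewrite ltrDl.
  exists (M + 1); first exact: le_trans (HM 0%N).
  by move=> k; exact: le_trans (ler_norm _) (HM k).
have [||//|_] := @Rn_int_cvg R n (8 * sigma)^-1 (B * K)
  (fun k v => G v (t_ (k + N)%N) * hk s (t_ (k + N)%N) v)
  (fun v => G v sigma * hk s sigma v) a0.
- by move=> k; case: (hint_nice (tpos k) cG GB).
- move=> k v; rewrite normrM [`|hk _ _ _|]ger0_norm ?hk_ge0// -mulrA.
  apply: ler_pM => //; first exact: hk_ge0.
  apply: ler_pM; rewrite ?invr_ge0 ?powR_ge0 ?expR_ge0 ?HK//.
  rewrite ler_expR lerN2 mulrC ler_wpM2l ?sqnorm_ge0// lef_pV2 ?posrE ?mulr_gt0//.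
  by have /andP[_] := tN' k; lra.
- move=> v; apply: cvgM; first by apply: cG => //; exact: tends_cst.
  apply: cvgM; first exact: cp.
  apply: cvg_expR; apply: cvgN; apply: cvgM; first exact: cvg_cst.
  apply: cvgV; first by rewrite gt_eqF ?mulr_gt0.
  by apply: cvgM; first exact: cvg_cst.
by [].
Unshelve. all: by end_near. Qed.

Lemma hint_measurable G B (D : set R) : measurable D -> D `<=` `]0, +oo[ ->
  jcont G -> (forall v t, `|G v t| <= B) -> measurable_fun D (hint s G).
Proof.
move=> mD D0 cG GB; apply: (measurable_funS _ D0); first exact: measurable_itv.
apply: open_continuous_measurable_fun => [|x]; first exact: interval_open.
rewrite inE/= in_itv/= andbT => x0; exact: hint_continuous.
Qed.

Lemma itvcy_pos (d : R) : 0 < d -> `[d, +oo[ `<=` `]0, +oo[.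
Proof.
by move=> d0 x; rewrite /= !in_itv/= !andbT; exact: lt_le_trans.
Qed.

Lemma hint_integrable G B d : 0 < s -> 0 < d -> jcont G ->
  (forall v t, `|G v t| <= B) ->
  mu.-integrable `[d, +oo[ (EFin \o hint s G).
Proof.
move=> s0 d0 cG GB.
have ip : mu.-integrable `[d, +oo[ (EFin \o
    (fun x : R => B * Num.sqrt (4 * pi) ^+ n * x `^ (- (1 + s)))).
  rewrite (_ : EFin \o _ = (fun x : R => (B * Num.sqrt (4 * pi) ^+ n)%:E *
     (EFin \o (fun x : R => x `^ (- (1 + s)))%R) x)%E).
    by apply: integrableZl => //; exact: integrable_powR_tail.
  by apply/funext => x /=; rewrite EFinM.
apply: le_integrable ip => //.
  by apply/measurable_EFinP; apply: hint_measurable GB => //; exact: itvcy_pos.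
move=> x /= xd; rewrite lee_fin; apply: le_trans (hint_bound _ cG GB) _.
  by have := itvcy_pos d0 xd; rewrite /= in_itv/= andbT.
by rewrite mulrA ler_norm.
Qed.

End hint_theory.

End heat_integral.

(** * The operator in centred form *)

Section principal_value.
Variable R : realType.
Notation mu := (@lebesgue_measure R).

Lemma cvg_enorm n (v_ : nat -> 'rV[R]_n) v :
  tends v_ v -> enorm (v_ k) @[k --> \oo] --> enorm v.
Proof.
move=> vv; apply: (@continuous_cvg _ _ _ _ _ _ (@Num.sqrt R)) (cvg_sqnorm vv).
exact: sqrt_continuous.
Qed.

Lemma trunc_dom n (a C eps : R) (F : 'rV[R]_n -> R) : gdom a C F ->
  gdom a C (fun v => if eps < enorm v then F v else 0).
Proof.
move=> FC v; case: ifP => // _.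
by rewrite normr0 mulr_ge0 ?expR_ge0 ?(gdom_ge0 FC).
Qed.

(* 1 - exp(-k(d + |d|)) is continuous in d and increases to the indicator of d > 0. *)
Lemma trunc_meas n (a C eps : R) (F : 'rV[R]_n -> R) : 0 < a ->
  gdom a C F -> seqcont F ->
  Rn_meas (fun v => if eps < enorm v then F v else 0).
Proof.
move=> a0 FC cF.
pose d (v : 'rV[R]_n) := (enorm v - eps) + `|enorm v - eps|.
have d0 v : 0 <= d v by rewrite /d -lerBlDl sub0r -normrN ler_norm.
pose f_ (k : nat) v := F v * (1 - expR (- (k%:R * d v))).
have fd k : gdom a C (f_ k).
  move=> v; apply: le_trans (FC v); rewrite normrM ler_piMr//.
  have e0 := expR_ge0 (- (k%:R * d v)).
  have e1 : expR (- (k%:R * d v)) <= 1.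
    by rewrite -expR0 ler_expR oppr_le0 mulr_ge0.
  by rewrite ler_norml; apply/andP; split; lra.
have [||//] := @Rn_int_cvg R n a C f_ (fun v => if eps < enorm v then F v else 0) a0 _ fd.
- move=> k; apply: (seqcont_meas a0 (fd k)) => v_ v vv.
  apply: cvgM (cF _ _ vv) _; apply: cvgB; first exact: cvg_cst.
  apply: cvg_expR; apply: cvgN; apply: cvgM; first exact: cvg_cst.
  have ce : enorm (v_ k) - eps @[k --> \oo] --> enorm v - eps.
    by apply: cvgB (cvg_enorm vv) (cvg_cst _).
  by apply: cvgD; [exact: ce|apply: cvg_norm; exact: ce].
move=> v; case: ltP => ev; last first.
  rewrite (_ : (fun k => f_ k v) = (fun=> 0)); first exact: cvg_cst.
  apply/funext => k; rewrite /f_ /d ler0_norm ?subr_le0//.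
  by rewrite subrr mulr0 oppr0 expR0 subrr mulr0.
have dv : 0 < d v by rewrite /d ltr_pwDl ?subr_gt0.
rewrite -[X in _ --> X]mulr1; apply: cvgM; first exact: cvg_cst.
rewrite -[X in _ --> X](subr0 1); apply: cvgB; first exact: cvg_cst.
have E k : expR (- (k%:R * d v)) = expR (- d v) ^+ k.
  by rewrite -expRM_natl mulrN.
under eq_fun do rewrite E.
apply: cvg_expr; rewrite ger0_norm ?expR_ge0//.
by rewrite -expR0 ltr_expR oppr_lt0.
Qed.

(** The truncations converge to [F] off the origin. In positive dimension the discrepancy lies in
    the slice where the first coordinate is 0, a null set for the outer integral; in dimension 0 the
    origin would carry all the mass. *)
Lemma Rn_int_pv n (a C : R) (F : 'rV[R]_n.+1 -> R) : 0 < a ->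
  gdom a C F -> seqcont F ->
  Rn_int (fun v => if k.+1%:R^-1 < enorm v then F v else 0) @[k --> \oo] --> Rn_int F.
Proof.
move=> a0 FC cF.
pose f0 (v : 'rV[R]_n.+1) := if 0 < enorm v then F v else 0.
have [|||m0 c0] := @Rn_int_cvg R n.+1 a C
  (fun k v => if k.+1%:R^-1 < enorm v then F v else 0) f0 a0.
- by move=> k; exact: trunc_meas FC cF.
- by move=> k; exact: trunc_dom.
- move=> v; rewrite /f0; case: ltP => ev; last first.
    rewrite (_ : (fun k : nat => _) = (fun=> 0)); first exact: cvg_cst.
    apply/funext => k; rewrite ltNge (le_trans ev)//.
  apply: cvg_near_cst; near=> k; rewrite ifT//.
  rewrite invf_plt ?posrE//.
  rewrite (@lt_le_trans _ _ (k%:R))// ?ler_nat//; near: k.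
  exact: nbhs_infty_gtr.
rewrite (_ : Rn_int F = Rn_int f0)//.
have mF := seqcont_meas a0 FC cF.
have [mF1 _] := Rn_measS mF; have [m01 _] := Rn_measS m0.
rewrite /= /Rintegral; congr fine.
rewrite -(@integral_setD1 R _ 0 setT)//; last 2 first.
- exact: measurableD.
- by apply/measurable_EFinP; exact: measurable_funS mF1.
rewrite -[RHS](@integral_setD1 R _ 0 setT)//; last 2 first.
- exact: measurableD.
- by apply/measurable_EFinP; exact: measurable_funS m01.
apply: eq_integral => y; rewrite inE => -[_ /= y0].
congr EFin; apply: eq_Rn_int => v; rewrite /f0 ifT//.
rewrite /enorm sqrtr_gt0 sqnorm_vcons ltr_pwDl ?sqnorm_ge0//.
by rewrite exprn_even_gt0//=; apply/eqP.
Unshelve. all: by end_near. Qed.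

Definition incr n (u : 'rV[R]_n -> R -> R) x t (v : 'rV[R]_n) sigma : R :=
  u x t - u (x + v) (t - sigma).

Lemma jcont_incr n (u : 'rV[R]_n -> R -> R) x t : jcont u -> jcont (incr u x t).
Proof.
move=> cu v_ v s_ s vv ss; apply: cvgB; first exact: cvg_cst.
apply: cu; first by apply: tendsD => //; exact: tends_cst.
by apply: cvgB => //; exact: cvg_cst.
Qed.

Lemma incr_bound n (u : 'rV[R]_n -> R -> R) (M : R) x t :
  (forall x t, `|u x t| <= M) -> forall v sigma, `|incr u x t v sigma| <= M + M.
Proof. by move=> uM v sigma; apply: le_trans (ler_normB _ _) _; exact: lerD. Qed.

Lemma sqnormN n (v : 'rV[R]_n) : sqnorm (- v) = sqnorm v.
Proof. by apply: eq_bigr => i _; rewrite mxE sqrrN. Qed.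

(** At a positive lag a bounded [u] makes the integrand absolutely integrable, so the principal
    value is an ordinary integral. As the limit is assumed to exist, the radii 1/(k+1) suffice to
    identify it. *)
Lemma frac_heat_inner_hint n (s M : R) (u : 'rV[R]_n.+1 -> R -> R)
    (x : 'rV[R]_n.+1) (t tau : R) :
  jcont u -> (forall x t, `|u x t| <= M) -> tau < t ->
  cvg (frac_heat_inner_trunc s u x t tau eps @[eps --> 0^'+]) ->
  frac_heat_inner s u x t tau = hint s (incr u x t) (t - tau).
Proof.
move=> cu uM tt cv.
have s0 : 0 < t - tau by rewrite subr_gt0.
pose F (v : 'rV[R]_n.+1) : R := incr u x t v (t - tau) * hk s (t - tau) v.
have [_ [C FC]] : Rn_nice ((4 * (t - tau))^-1 / 2) F.
  by apply: (@hint_nice _ _ s _ (M + M)) => //; [exact: jcont_incr|exact: incr_bound uM].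
have cF : seqcont F.
  move=> v_ v vv; apply: cvgM (seqcont_hk vv).
  exact: (jcont_slice (jcont_incr cu)).
have a0 := hk_rate_gt0 s0.
have E eps : frac_heat_inner_trunc s u x t tau eps =
    Rn_int (fun v => if eps < enorm v then F v else 0).
  rewrite -(Rn_int_shift (- x) (trunc_meas eps a0 FC cF)).
  apply: eq_Rn_int => y; rewrite [- x + y]addrC; case: ifP => // _.
  rewrite /frac_heat_kernel /F /incr /hk (subKr t) [x + (y - x)]addrC subrK.
  by rewrite -(sqnormN (y - x)) opprB mulrA.
have e_cvg : (k.+1%:R^-1 : R) @[k --> \oo] --> 0^'+.
  move=> P [e /= e0 HP].
  suff : \forall k \near \oo, P (k.+1%:R^-1) by [].
  near=> k; apply: HP => //=.
  rewrite sub0r normrN ger0_norm// invf_plt ?posrE//.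
  by rewrite (@lt_le_trans _ _ (k%:R))// ?ler_nat//; near: k; exact: nbhs_infty_gtr.
have c1 : frac_heat_inner_trunc s u x t tau (k.+1%:R^-1) @[k --> \oo] -->
    frac_heat_inner s u x t tau.
  exact: (cvg_comp _ _ e_cvg cv).
have c2 : frac_heat_inner_trunc s u x t tau (k.+1%:R^-1) @[k --> \oo] --> Rn_int F.
  under eq_cvg do rewrite E.
  exact: (Rn_int_pv a0 FC cF).
exact: (cvg_unique _ c1 c2).
Unshelve. all: by end_near. Qed.

(** The positive constant is divided out and the time variable reflected into the lag. The limit in
    [d] stays, since integrability down to lag 0 is not known. *)
Lemma frac_heat_value_hint n (s M : R) (u : 'rV[R]_n.+1 -> R -> R)
    (x : 'rV[R]_n.+1) (t : R) :
  0 < s < 1 -> jcont u -> (forall x t, `|u x t| <= M) ->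
  frac_heat_value s u x t 0 ->
  \int[mu]_(sigma in `[d, +oo[) hint s (incr u x t) sigma @[d --> 0^'+] --> 0.
Proof.
move=> s01 cu uM [cv val].
have Cn := C_ns_gt0 n.+1 s01.
have {}val : (C_ns n.+1 s)^-1 * (C_ns n.+1 s * Rintegral lebesgue_measure `]-oo, t - d]
          (fun tau => frac_heat_inner s u x t tau)) @[d --> 0^'+] --> 0.
  rewrite -[X in _ --> X](mulr0 (C_ns n.+1 s)^-1).
  by apply: cvgM; [exact: cvg_cst|exact: val].
apply: cvg_trans val; apply: near_eq_cvg; near=> d.
have d0 : 0 < d by [].
rewrite mulKf ?gt_eqF//.
have pre : (fun y => t - y) @^-1` `[d, +oo[ = `]-oo, t - d]%classic.
  by apply/seteqP; split => y; rewrite /= !in_itv/= ?andbT lerBrDl addrC lerBrDl.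
rewrite [RHS](Rintegral_reflect t).
- rewrite pre; apply: eq_Rintegral => tau; rewrite inE/= in_itv/= => td.
  have tt : tau < t by apply: le_lt_trans td _; rewrite gtrBl.
  by apply: (frac_heat_inner_hint cu uM tt); exact: cv.
- exact: measurable_itv.
- apply: (@hint_measurable _ _ _ _ (M + M)).
  + exact: measurable_itv.
  + exact: itvcy_pos.
  + exact: jcont_incr.
  + exact: incr_bound uM.
Unshelve. all: by end_near. Qed.

End principal_value.

(** * Lower bound for the mass at lags at least 1 *)

Section lower_bound.
Variable R : realType.
Notation mu := (@lebesgue_measure R).

Lemma Rn_int_sum n m (a : R) (f : 'I_m -> 'rV[R]_n -> R) : 0 < a ->
  (forall i, Rn_nice a (f i)) ->
  Rn_nice a (fun v => \sum_i f i v) /\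
  Rn_int (fun v => \sum_i f i v) = \sum_i Rn_int (f i).
Proof.
move=> a0; elim: m f => [|m IH] f nf.
  under eq_fun do rewrite big_ord0; rewrite big_ord0; split; first exact: Rn_nice0.
  have [_] := Rn_intZ 0 a0 (Rn_nice0 n a0); rewrite [RHS]mul0r => e; rewrite -[RHS]e.
  by apply: eq_Rn_int => v; rewrite mul0r.
have [n1 e1] := IH (fun i => f (lift ord0 i)) (fun i => nf _).
have [n2 e2] := Rn_int_lin 1 a0 (nf ord0) n1.
have E : (fun v => \sum_i f i v) =
    (fun v => 1 * f ord0 v + \sum_(i < m) f (lift ord0 i) v).
  by apply/funext => v; rewrite big_ord_recl mul1r.
by rewrite E; split => //; rewrite e2 e1 mul1r big_ord_recl.
Qed.

Lemma gexp_mul_nice n (a B : R) (b : 'rV[R]_n) (g : 'rV[R]_n -> R) : 0 < a ->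
  (forall v, `|g v| <= B) -> seqcont g ->
  Rn_nice (a / 2) (fun v => g v * gexp a b v).
Proof.
move=> a0 gB cg.
apply: (@seqcont_nice _ _ _ (B * expR (sqnorm b / (2 * a)))).
- by rewrite divr_gt0.
- by move=> v; rewrite normrM -mulrA ler_pM//; exact: gexp_dom.
- by move=> v_ v vv; apply: cvgM (cg _ _ vv) _; exact: seqcont_gexp.
Qed.

Lemma Rintegral_sum_ord m (D : set R) (f : 'I_m -> R -> R) : measurable D ->
  (forall i, mu.-integrable D (EFin \o f i)) ->
  mu.-integrable D (EFin \o (fun x => \sum_i f i x)) /\
  \int[mu]_(x in D) (\sum_i f i x) = \sum_i \int[mu]_(x in D) f i x.
Proof.
move=> mD; elim: m f => [|m IH] f fi.
  under eq_fun do rewrite big_ord0; rewrite big_ord0; split.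
    by rewrite (_ : EFin \o _ = cst 0%E)//; exact: integrable0.
  by rewrite Rintegral_cst// mul0r.
have [i1 e1] := IH (fun i => f (lift ord0 i)) (fun i => fi _).
have E : (fun x => \sum_i f i x) = (fun x => f ord0 x + \sum_(i < m) f (lift ord0 i) x).
  by apply/funext => x; rewrite big_ord_recl.
rewrite E; split; last by rewrite RintegralD// e1 big_ord_recl.
have -> : EFin \o (fun x => f ord0 x + \sum_(i < m) f (lift ord0 i) x) =
    ((EFin \o f ord0) \+ (EFin \o (fun x => (\sum_(i < m) f (lift ord0 i) x)%R)))%E by [].
exact: integrableD.
Qed.

Lemma Rintegral_subset (A B : set R) (f : R -> R) :
  measurable A -> measurable B -> mu.-integrable B (EFin \o f) ->
  (forall x, B x -> 0 <= f x) -> A `<=` B ->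
  \int[mu]_(x in A) f x <= \int[mu]_(x in B) f x.
Proof.
move=> mA mB fi f0 AB; apply: fine_le.
- by apply: integrable_fin_num => //; exact: integrableS fi.
- exact: integrable_fin_num.
- by apply: ge0_subset_integral => //; case/integrableP : fi.
Qed.

Lemma gexp_recenter n (b v : 'rV[R]_n) :
  gexp 2^-1 b (b + v) = expR (sqnorm b / 2) * gexp 2^-1 0 v.
Proof.
rewrite /gexp -expRD; congr expR.
rewrite /sqnorm !mulr_sumr mulr_suml -!sumrN -!big_split/=.
by apply: eq_bigr => i _; rewrite !mxE; field.
Qed.

(** For sigma >= 1 the exponent is at least -|v|^2/4, and |b - v/2|^2 >= 0 compares this with the
    Gaussian tilted by [b]. The power of sigma is bounded through sigma <= S. *)
Lemma hk_ge_gexp n (s S L sigma : R) (b v : 'rV[R]_n) :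
  0 < s -> 1 <= sigma <= S -> sqnorm b <= L ->
  (S `^ (n%:R / 2 + 1 + s))^-1 * expR (- L) * gexp 2^-1 b v <= hk s sigma v.
Proof.
move=> s0 /andP[s1 sS] bL.
have sg0 : 0 < sigma by exact: lt_le_trans s1.
have S0 : 0 < S by exact: lt_le_trans sS.
rewrite /hk -mulrA; apply: ler_pM.
- by rewrite invr_ge0 powR_ge0.
- by rewrite mulr_ge0 ?expR_ge0.
- rewrite lef_pV2 ?posrE ?powR_gt0//.
  apply: ge0_ler_powR; rewrite ?nnegrE ?(ltW S0) ?(ltW sg0)//.
  by rewrite !addr_ge0 ?divr_ge0 ?(ltW s0).
rewrite /gexp -expRD ler_expR.
apply: (@le_trans _ _ (- (sqnorm v / 4))); last first.
  rewrite lerN2 ler_wpM2l ?sqnorm_ge0// lef_pV2 ?posrE ?mulr_gt0//.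
  by rewrite ler_peMr.
apply: (@le_trans _ _ (- sqnorm b + (\sum_i b 0 i * v 0 i - 2^-1 * sqnorm v))).
  by rewrite lerD2r lerN2.
rewrite /sqnorm mulr_sumr mulr_suml -!sumrN -!big_split/=.
apply: ler_sum => i _; rewrite -subr_ge0.
rewrite (_ : _ - _ = (b 0 i - v 0 i / 2) ^+ 2); last by field.
exact: sqr_ge0.
Qed.

(** The i-th kernel is bounded below by a Gaussian centred at [h *+ i]. Recentring moves that shift
    into the argument of [D], so all N terms are integrated against one Gaussian and evaluated along
    one orbit, where their sum is at least 1. *)
Lemma hint_shift_sum_lower n (s k S L sigma a B : R) N (h : 'rV[R]_n)
    (D : 'rV[R]_n -> R -> R) x t : 0 < s ->
  jcont D -> (forall y r, `|D y r| <= B) -> (forall y r, 0 <= D y r) ->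
  (forall y r, 1 <= \sum_(i < N) D (y + h *+ i) (r + k *+ i)) ->
  (forall i : 'I_N, 1 <= a - k *+ i + sigma <= S) ->
  (forall i : 'I_N, sqnorm (h *+ i) <= L) ->
  (S `^ (n%:R / 2 + 1 + s))^-1 * expR (- L) * Num.sqrt (pi / 2^-1) ^+ n <=
  \sum_(i < N) hint s (fun v r => D (x + v) (t - r)) (a - k *+ i + sigma).
Proof.
move=> s0 cD DB D0 DN aS hL.
set c0 := _^-1 * expR (- L).
have c00 : 0 <= c0 by rewrite mulr_ge0 ?expR_ge0 ?invr_ge0 ?powR_ge0.
have q0 : 0 < 2^-1 / 2 :> R by rewrite divr_gt0.
have sD (y : 'rV[R]_n) r : seqcont (fun v => D (y + v) r).
  move=> v_ v vv; apply: cD; last exact: cvg_cst.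
  by apply: tendsD => //; exact: tends_cst.
(* After recentring, the i-th term is the i-th shift of the base point (x + v, t - (a + sigma)),
   which does not depend on i. *)
pose g (i : 'I_N) v := D (x + h *+ i + v) (t - (a + sigma) + k *+ i) * gexp 2^-1 0 v.
have nf i : Rn_nice (2^-1 / 2) (g i) by apply: (@gexp_mul_nice _ _ B).
have step (i : 'I_N) : c0 * Rn_int (g i)
    <= hint s (fun v r => D (x + v) (t - r)) (a - k *+ i + sigma).
  have := aS i; set sg := a - k *+ i + sigma => /andP[sg1 sgS].
  have sg0 : 0 < sg by exact: lt_le_trans sg1.
  have nG : Rn_nice (2^-1 / 2) (fun v => D (x + v) (t - sg) * gexp 2^-1 (h *+ i) v).
    by apply: (@gexp_mul_nice _ _ B).
  have E : Rn_int (fun v => D (x + v) (t - sg) * gexp 2^-1 (h *+ i) v) =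
      expR (sqnorm (h *+ i) / 2) * Rn_int (g i).
    rewrite -(Rn_int_shift (h *+ i) nG.1) -(proj2 (Rn_intZ _ q0 (nf i))).
    apply: eq_Rn_int => v; rewrite /g gexp_recenter addrA.
    rewrite (_ : t - sg = t - (a + sigma) + k *+ i); last by rewrite /sg; ring.
    by rewrite mulrCA.
  apply: (@le_trans _ _ (c0 * Rn_int (fun v => D (x + v) (t - sg) * gexp 2^-1 (h *+ i) v))).
    rewrite ler_wpM2l// E ler_peMl//.
      by apply: Rn_int_ge0 => v; rewrite mulr_ge0 ?expR_ge0.
    by rewrite -expR0 ler_expR divr_ge0 ?sqnorm_ge0.
  rewrite -(proj2 (Rn_intZ _ q0 nG)).
  have r0 := hk_rate_gt0 sg0.
  apply: (Rn_int_le r0).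
  - apply: Rn_niceS (proj1 (Rn_intZ _ q0 nG)).
    rewrite ler_wpM2r// lef_pV2 ?posrE ?mulr_gt0//.
    by move: sg1; lra.
  - by apply: (@hk_nice _ _ _ _ B).
  - move=> v; rewrite mulrCA ler_wpM2l//.
    by apply: hk_ge_gexp => //; rewrite sg1.
apply: le_trans (ler_sum _ (fun i _ => step i)).
rewrite -mulr_sumr ler_wpM2l//.
have [ns es] := Rn_int_sum q0 nf.
rewrite -es; have := Rn_int_gexp (0 : 'rV[R]_n) (_ : 0 < 2^-1 :> R).
have -> : sqnorm (0 : 'rV[R]_n) = 0 by rewrite /sqnorm big1// => i _; rewrite mxE expr0n.
rewrite mul0r expR0 mulr1 => <- //.
apply: (Rn_int_le q0) => //; first exact: gexp_nice.
move=> v; rewrite -mulr_suml ler_peMl ?expR_ge0//.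
apply: le_trans (DN (x + v) (t - (a + sigma))) _.
by apply: ler_sum => i _; rewrite addrAC.
Qed.

(* The constant does not depend on [D]: this is what contradicts the O(eta) upper
   bound at the maximum point. *)
Lemma hint_tail_lower n (s k : R) N (h : 'rV[R]_n) : 0 < s -> (0 < N)%N ->
  exists2 c : R, 0 < c & forall (D : 'rV[R]_n -> R -> R) B x t,
    jcont D -> (forall y r, `|D y r| <= B) -> (forall y r, 0 <= D y r) ->
    (forall y r, 1 <= \sum_(i < N) D (y + h *+ i) (r + k *+ i)) ->
    c <= \int[mu]_(sigma in `[1, +oo[) hint s (fun v r => D (x + v) (t - r)) sigma.
Proof.
move=> s0 N0.
(* Since [k] may have either sign, [a] is large enough for every a - k i to be at least 1, and [S]
   bounds a - k i + sigma for sigma in [0,1]. *)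
pose a := `|k| *+ N + 1; pose S := `|k| *+ N + `|k| *+ N + 2.
pose L := \sum_(i < N) sqnorm (h *+ i).
pose c2 := (S `^ (n%:R / 2 + 1 + s))^-1 * expR (- L) * Num.sqrt (pi / 2^-1) ^+ n.
have kN0 : 0 <= `|k| *+ N by rewrite mulrn_wge0.
have S0 : 0 < S by rewrite /S; lra.
have c20 : 0 < c2.
  rewrite mulr_gt0 ?exprn_gt0 ?sqrtr_gt0 ?divr_gt0 ?pi_gt0//.
  by rewrite mulr_gt0 ?expR_gt0// invr_gt0 powR_gt0.
(* Each of the N unit windows of lags lies in [1,oo) but they may overlap, so the total is bounded
   by N times the tail integral. *)
exists (c2 / N%:R); first by rewrite divr_gt0 ?ltr0n.
move=> D B x t cD DB D0 DN.
set F := hint s _.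
have cG : jcont (fun v r => D (x + v) (t - r)).
  move=> v_ v r_ r vv rr; apply: cD; first by apply: tendsD => //; exact: tends_cst.
  by apply: cvgB => //; exact: cvg_cst.
have GB v r : `|D (x + v) (t - r)| <= B by [].
have ki (i : 'I_N) : `|k *+ i| <= `|k| *+ N.
  by rewrite normrMn ler_wpMn2l// ltnW.
have b1 (i : 'I_N) : 1 <= a - k *+ i.
  by have := ki i; rewrite ler_norml /a => /andP[_]; lra.
have iF : mu.-integrable `[1, +oo[ (EFin \o F) by exact: hint_integrable GB.
have F0 sigma : 0 <= F sigma by apply: Rn_int_ge0 => v; rewrite mulr_ge0 ?hk_ge0.
have Ipre (i : 'I_N) :
    (fun x => a - k *+ i + x) @^-1` `[a - k *+ i, a - k *+ i + 1] = `[0, 1]%classic.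
  by apply/seteqP; split => y; rewrite /= !in_itv/= lerDl lerD2l.
have Isub (i : 'I_N) : `[a - k *+ i, a - k *+ i + 1] `<=` `[1, +oo[.
  move=> y; rewrite /= !in_itv/= andbT => /andP[+ _]; exact: le_trans.
have mF (i : 'I_N) : measurable_fun `[a - k *+ i, a - k *+ i + 1] F.
  apply: (@hint_measurable _ _ _ _ B) => //.
  by apply: subset_trans (Isub i) _; exact: itvcy_pos.
have cFi (i : 'I_N) : {within `[0, 1], continuous (fun y => F (a - k *+ i + y))}.
  apply: continuous_in_subspaceT => y; rewrite inE/= in_itv/= => /andP[y0 _].
  apply: (@continuous_comp _ _ _ (fun y => a - k *+ i + y) F).
    by apply: cvgD; [exact: cvg_cst|exact: cvg_id].
  by apply: (hint_continuous _ cG GB); have := b1 i; lra.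
have iFi (i : 'I_N) : mu.-integrable `[0, 1] (EFin \o (fun y => F (a - k *+ i + y))).
  by apply: continuous_compact_integrable; [exact: segment_compact|exact: cFi].
have [iS eS] := Rintegral_sum_ord (measurable_itv _) iFi.
have up : \sum_(i < N) \int[mu]_(y in `[0, 1]) F (a - k *+ i + y) <=
    \sum_(i < N) \int[mu]_(y in `[1, +oo[) F y.
  apply: ler_sum => i _; rewrite -(Ipre i) -Rintegral_shift//.
  exact: Rintegral_subset.
rewrite ler_pdivrMr ?ltr0n// mulr_natr.
move: up; rewrite sumr_const card_ord => /(le_trans _); apply.
rewrite -eS.
have -> : c2 = \int[mu]_(y in `[0, 1]) c2.
  rewrite Rintegral_cst//= lebesgue_measure_itv/= lte_fin ltr01/=.
  by rewrite subr0 mulr1.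
apply: le_Rintegral => //.
  by apply: continuous_compact_integrable; [exact: segment_compact|move=> y; exact: cst_continuous].
move=> y; rewrite /= in_itv/= => /andP[y0 y1].
apply: (@hint_shift_sum_lower _ _ _ _ _ _ _ B) => //.
- move=> i; apply/andP; split; first by have := b1 i; lra.
  have := ki i; rewrite ler_norml /a /S => /andP[+ _]; lra.
- move=> i; rewrite /L (bigD1 i)//= lerDl sumr_ge0// => j _; exact: sqnorm_ge0.
Qed.

End lower_bound.

(** * The bump perturbation *)

Section bump.
Variable R : realType.
Notation mu := (@lebesgue_measure R).

Section bump_def.
Variables (n : nat) (x0 : 'rV[R]_n) (t0 : R).

(** Each spatial term 2 cosh(d) - 2 behaves like d^2 near 0; exponentials are preferred to squares
    so that [Rn_int_gexp] replaces the computation of second moments. *)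
Definition rho (y : 'rV[R]_n) (r : R) : R :=
  \sum_i (expR (y 0 i - x0 0 i) + expR (- (y 0 i - x0 0 i)) - 2) + (r - t0) ^+ 2.

Definition psi (y : 'rV[R]_n) (r : R) : R := Num.max 0 (1 - rho y r).

Let cosh2_ge0 (d : R) : 0 <= expR d + expR (- d) - 2.
Proof. by have := expR_ge1Dx d; have := expR_ge1Dx (- d); lra. Qed.

Lemma rho_ge0 y r : 0 <= rho y r.
Proof. by rewrite addr_ge0 ?sqr_ge0// sumr_ge0. Qed.

Lemma rho_center : rho x0 t0 = 0.
Proof.
rewrite /rho subrr expr0n addr0 big1// => i _.
by rewrite subrr oppr0 expR0; lra.
Qed.

Lemma psi_ge0 y r : 0 <= psi y r.
Proof. by rewrite le_max lexx. Qed.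

Lemma psi_le1 y r : psi y r <= 1.
Proof. by rewrite ge_max ler01 gerBl rho_ge0. Qed.

Lemma psi_ge y r : 1 - rho y r <= psi y r.
Proof. by rewrite le_max lexx orbT. Qed.

Lemma psi_eq y r : rho y r <= 1 -> psi y r = 1 - rho y r.
Proof. by move=> h; rewrite /psi max_r// subr_ge0. Qed.

Lemma rho_cosh_le y r i : rho y r <= 1 ->
  expR (y 0 i - x0 0 i) + expR (- (y 0 i - x0 0 i)) <= 3.
Proof.
rewrite /rho (bigD1 i)//=; set T := \sum_(j < n | _) _.
have T0 : 0 <= T by rewrite sumr_ge0.
by have := sqr_ge0 (r - t0); lra.
Qed.

(** From 1 + d <= e^d <= 3, and the same for -d, follows |d| <= 2. The explicit box supplies the
    compact set for [bump_max]. *)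
Lemma rho_le1_box y r : rho y r <= 1 ->
  (forall i, `|y 0 i - x0 0 i| <= 2) /\ `|r - t0| <= 1.
Proof.
move=> h; split.
  move=> i; have := rho_cosh_le i h.
  have := expR_ge1Dx (y 0 i - x0 0 i); have := expR_ge1Dx (- (y 0 i - x0 0 i)).
  have := expR_ge0 (y 0 i - x0 0 i); have := expR_ge0 (- (y 0 i - x0 0 i)).
  by rewrite ler_norml; lra.
rewrite -(@expr_le1 _ 2)// real_normK ?num_real//.
apply: le_trans h; rewrite /rho lerDr sumr_ge0//.
Qed.

Lemma jcont_rho : jcont rho.
Proof.
move=> x_ x t_ t xx tt; apply: cvgD.
  apply: cvg_sum_ord => i; apply: cvgB; last exact: cvg_cst.
  have cd : x_ k 0 i - x0 0 i @[k --> \oo] --> x 0 i - x0 0 i.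
    by apply: cvgB (xx i) (cvg_cst _).
  by apply: cvgD; apply: cvg_expR => //; exact: cvgN.
have cd : t_ k - t0 @[k --> \oo] --> t - t0 by apply: cvgB => //; exact: cvg_cst.
by rewrite expr2; under eq_cvg do rewrite expr2; exact: cvgM.
Qed.

Lemma psiE y r : psi y r = ((1 - rho y r) + `|1 - rho y r|) / 2.
Proof.
rewrite /psi; case: (leP 0 (1 - rho y r)) => h.
  by rewrite ger0_norm//; lra.
by rewrite ler0_norm ?ltW//; lra.
Qed.

Lemma jcont_psi : jcont psi.
Proof.
move=> x_ x t_ t xx tt; rewrite psiE; under eq_cvg do rewrite psiE.
have c1 : 1 - rho (x_ k) (t_ k) @[k --> \oo] --> 1 - rho x t.
  by apply: cvgB; [exact: cvg_cst|exact: jcont_rho].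
apply: cvgM; last exact: cvg_cst.
by apply: cvgD => //; exact: cvg_norm.
Qed.

End bump_def.

(** If continuity failed, choosing a bad point in each ball of radius 1/(k+1) would give a
    convergent sequence contradicting [jcont]. The filter form is what the extreme value theorem
    takes. *)
Lemma jcont_continuous n (f : 'rV[R]_n -> R -> R) : jcont f ->
  continuous (fun p : 'rV[R]_n * R => f p.1 p.2).
Proof.
move=> cf [x t]; apply/cvgrPdist_le => /= e e0; apply: contrapT => nn.
have H (k : nat) : exists p : 'rV[R]_n * R,
    [/\ forall i, `|x 0 i - p.1 0 i| < k.+1%:R^-1, `|t - p.2| < k.+1%:R^-1 &
        e < `|f x t - f p.1 p.2|].
  apply: contrapT => nH; apply: nn.
  have k0 : 0 < k.+1%:R^-1 :> R by [].
  exists (ball x k.+1%:R^-1, ball t k.+1%:R^-1) => /=.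
    by split; exact: nbhsx_ballx.
  move=> p [/= [_ xp] tp]; rewrite leNgt; apply/negP => ep; apply: nH; exists p; split => //.
  by move=> i; exact: xp.
have [p_ Hp] := choice H.
have i0 : (k.+1%:R^-1 : R) @[k --> \oo] --> 0 by exact: cvg_harmonic.
have small (g : nat -> R) (l : R) : (forall k, `|l - g k| < k.+1%:R^-1) -> g k @[k --> \oo] --> l.
  move=> gl; apply/cvgrPdist_lt => d d0; near=> k.
  apply: lt_trans (gl k) _; near: k.
  have /cvgrPdist_lt/(_ d d0) := i0; apply: filterS => k.
  by rewrite sub0r normrN ger0_norm.
have /cvgrPdist_le/(_ e e0) : f (p_ k).1 (p_ k).2 @[k --> \oo] --> f x t.
  apply: cf; first by move=> i; apply: small => k; case: (Hp k).
  by apply: small => k; case: (Hp k).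
move=> [N _ /(_ N (leqnn _))]/=; rewrite leNgt => /negP; apply.
by case: (Hp N).
Unshelve. all: by end_near. Qed.

(** The factor 2 is decisive: at the centre the perturbed function exceeds A - eta + 2 eta = A +
    eta, while off the support of [psi] it is at most A. A maximum over the box is therefore global
    and lies where rho <= 1. *)
Lemma bump_max n (w : 'rV[R]_n -> R -> R) (A eta : R) x0 t0 : 0 < eta ->
  jcont w -> (forall y r, w y r <= A) -> A - eta < w x0 t0 ->
  exists x t, rho x0 t0 x t <= 1 /\
    forall y r, w y r + 2 * eta * psi x0 t0 y r <= w x t + 2 * eta * psi x0 t0 x t.
Proof.
move=> eta0 cw wA w0.
pose W y r := w y r + 2 * eta * psi x0 t0 y r.
have cW : jcont W.
  move=> x_ x t_ t xx tt; apply: cvgD; first exact: cw.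
  by apply: cvgM; [exact: cvg_cst|exact: jcont_psi].
pose K := [set v : 'rV[R]_n | forall i, `[x0 0 i - 2, x0 0 i + 2]%classic (v 0 i)]
  `*` `[t0 - 1, t0 + 1].
have cK : compact K.
  apply: compact_setX; last exact: segment_compact.
  apply: (@rV_compact R n (fun i => `[x0 0 i - 2, x0 0 i + 2]%classic)) => i.
  exact: segment_compact.
have K0 : K (x0, t0).
  by split => /= [i|]; rewrite in_itv/=; apply/andP; split; lra.
have [[x t] _ HK] := compact_EVT_max (ex_intro _ _ K0) cK
  (continuous_subspaceT (jcont_continuous cW)).
have inK y r : rho x0 t0 y r <= 1 -> K (y, r).
  move=> /rho_le1_box[yb rb]; split => /=.
    by move=> i; rewrite in_itv/=; have := yb i; rewrite ler_norml; lra.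
  by rewrite in_itv/=; move: rb; rewrite ler_norml; lra.
have Wc : A + eta < W x0 t0.
  have p1 : psi x0 t0 x0 t0 = 1 by rewrite psi_eq rho_center ?subr0 ?ler01.
  by rewrite /W p1; lra.
have far y r : 1 < rho x0 t0 y r -> W y r <= A.
  by move=> h; rewrite /W /psi max_l ?mulr0 ?addr0// subr_le0 ltW.
have max0 : W x0 t0 <= W x t by apply: (HK (x0, t0)); rewrite inE.
have Wxt : rho x0 t0 x t <= 1.
  rewrite leNgt; apply/negP => /far; move: Wc max0; lra.
exists x, t; split => // y r.
case: (leP (rho x0 t0 y r) 1) => h; last by have := far _ _ h; rewrite /W in Wc max0 *; lra.
by apply: (HK (y, r)); rewrite inE; exact: inK.
Qed.

Let sum_delta n (v : 'rV[R]_n) i : \sum_j (delta_mx 0 i : 'rV[R]_n) 0 j * v 0 j = v 0 i.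
Proof.
rewrite (bigD1 i)//= big1 => [|j ji]; first by rewrite mxE !eqxx mul1r addr0.
by rewrite mxE (negbTE ji) andbF mul0r.
Qed.

Lemma gexp_delta n (a : R) (v : 'rV[R]_n) i :
  gexp a (delta_mx 0 i) v = expR (v 0 i) * gexp a 0 v.
Proof.
rewrite /gexp -expRD sum_delta; congr expR.
by rewrite big1 ?sub0r// => j _; rewrite mxE mul0r.
Qed.

Lemma gexp_deltaN n (a : R) (v : 'rV[R]_n) i :
  gexp a (- delta_mx 0 i) v = expR (- v 0 i) * gexp a 0 v.
Proof.
rewrite /gexp -expRD; congr expR; rewrite [X in _ = _ + (X - _)]big1 ?sub0r; last first.
  by move=> j _; rewrite mxE mul0r.
by under eq_bigr do rewrite mxE mulNr; rewrite sumrN sum_delta.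
Qed.

(** The increment of [rho] averages to O(sigma) against the Gaussian, which improves the mass
    sigma^(-1-s) to the integrable sigma^(-s). *)
Lemma rho_heat n (s sigma : R) x0 t0 (x : 'rV[R]_n) (t : R) : 0 < sigma <= 1 ->
  rho x0 t0 x t <= 1 ->
  Rn_nice ((4 * sigma)^-1 / 2)
    (fun v => (rho x0 t0 (x + v) (t - sigma) - rho x0 t0 x t) * hk s sigma v) /\
  Rn_int (fun v => (rho x0 t0 (x + v) (t - sigma) - rho x0 t0 x t) * hk s sigma v)
   <= (3 *+ n * expR 1 + 3) * Num.sqrt (4 * pi) ^+ n * sigma `^ (- s).
Proof.
move=> /andP[s0 s1] h.
pose a := (4 * sigma)^-1.
have a0 : 0 < a by rewrite invr_gt0 mulr_gt0.
have r0 : 0 < a / 2 by rewrite divr_gt0.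
pose c := (sigma `^ (n%:R / 2 + 1 + s))^-1.
pose d i := x 0 i - x0 0 i.
(* All terms of the increment of [rho] that are constant in v; the others are tilted Gaussians. *)
pose K0 := (t - sigma - t0) ^+ 2 - (t - t0) ^+ 2 - \sum_i (expR (d i) + expR (- d i)).
pose f1 (i : 'I_n) v := expR (d i) * gexp a (delta_mx 0 i) v.
pose f2 (i : 'I_n) v := expR (- d i) * gexp a (- delta_mx 0 i) v.
have n1 i : Rn_nice (a / 2) (f1 i).
  by case: (Rn_intZ (expR (d i)) r0 (gexp_nice (delta_mx 0 i) a0)).
have n2 i : Rn_nice (a / 2) (f2 i).
  by case: (Rn_intZ (expR (- d i)) r0 (gexp_nice (- delta_mx 0 i) a0)).
have [n1s e1s] := Rn_int_sum r0 n1.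
have [n2s e2s] := Rn_int_sum r0 n2.
have [n3 e3] := Rn_int_lin K0 r0 (gexp_nice 0 a0) n2s.
have [n4 e4] := Rn_int_lin 1 r0 n1s n3.
have [n5 e5] := Rn_intZ c r0 n4.
have E : (fun v => (rho x0 t0 (x + v) (t - sigma) - rho x0 t0 x t) * hk s sigma v) =
    (fun v => c * (1 * (\sum_i f1 i v) + (K0 * gexp a 0 v + \sum_i f2 i v))).
  apply/funext => v; rewrite hk_gexp -/a -/c.
  have g1 i : f1 i v = expR ((x + v) 0 i - x0 0 i) * gexp a 0 v.
    rewrite /f1 gexp_delta mulrA -expRD; congr (expR _ * _).
    by rewrite mxE /d; ring.
  have g2 i : f2 i v = expR (- ((x + v) 0 i - x0 0 i)) * gexp a 0 v.
    rewrite /f2 gexp_deltaN mulrA -expRD; congr (expR _ * _).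
    by rewrite mxE /d; ring.
  rewrite (eq_bigr _ (fun i _ => g1 i)) (eq_bigr _ (fun i _ => g2 i)) -!mulr_suml.
  by rewrite /rho /K0 !big_split/=; ring.
rewrite E; split => //; rewrite e5 e4 e3 e1s e2s.
have sq (b : 'rV[R]_n) i : b = delta_mx 0 i \/ b = - delta_mx 0 i -> sqnorm b = 1.
  move=> eb; rewrite /sqnorm (bigD1 i)//= big1 => [|j ji].
    by case: eb => ->; rewrite !mxE !eqxx/= ?sqrrN expr1n addr0.
  by case: eb => ->; rewrite !mxE (negbTE ji)/= ?oppr0 expr0n.
have I1 i : Rn_int (f1 i) = expR (d i) * (Num.sqrt (pi / a) ^+ n * expR sigma).
  rewrite (proj2 (Rn_intZ _ r0 (gexp_nice _ a0))) Rn_int_gexp// (sq _ i); last by left.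
  by congr (_ * (_ * expR _)); rewrite /a; field; rewrite gt_eqF.
have I2 i : Rn_int (f2 i) = expR (- d i) * (Num.sqrt (pi / a) ^+ n * expR sigma).
  rewrite (proj2 (Rn_intZ _ r0 (gexp_nice _ a0))) Rn_int_gexp// (sq _ i); last by right.
  by congr (_ * (_ * expR _)); rewrite /a; field; rewrite gt_eqF.
have I0 : Rn_int (gexp a (0 : 'rV[R]_n)) = Num.sqrt (pi / a) ^+ n.
  rewrite Rn_int_gexp// (_ : sqnorm 0 = 0) ?mul0r ?expR0 ?mulr1//.
  by rewrite /sqnorm big1// => i _; rewrite mxE expr0n.
have mass : c * Num.sqrt (pi / a) ^+ n = Num.sqrt (4 * pi) ^+ n * sigma `^ (- (1 + s)).
  rewrite -I0 -(Rn_int_hk n s s0).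
  rewrite -(proj2 (Rn_intZ _ r0 (gexp_nice _ a0))); apply: eq_Rn_int => v.
  by rewrite hk_gexp.
under eq_bigr do rewrite I1.
under [X in _ + (_ + X)]eq_bigr do rewrite I2.
rewrite I0 -!mulr_suml.
set P := Num.sqrt (pi / a) ^+ n in mass *.
set S1 := \sum_i expR (d i); set S2 := \sum_i expR (- d i).
have K0E : K0 = sigma ^+ 2 - 2 * sigma * (t - t0) - (S1 + S2).
  rewrite /K0 big_split/= -/S1 -/S2; ring.
(* Each exponential has been multiplied by e^sigma, so subtracting its value at the centre leaves
   the small factor e^sigma - 1. *)
rewrite (_ : c * _ = (c * P) * ((S1 + S2) * (expR sigma - 1) +
    (sigma ^+ 2 - 2 * sigma * (t - t0)))); last first.
  rewrite K0E; ring.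
rewrite mass.
have S3 : S1 + S2 <= 3 *+ n.
  rewrite -big_split/= -[X in _ <= _ *+ X]card_ord -sumr_const.
  by apply: ler_sum => i _; exact: rho_cosh_le h.
have S0 : 0 <= S1 + S2 by rewrite addr_ge0// sumr_ge0// => i _; exact: expR_ge0.
(* e^sigma - 1 = e^sigma (1 - e^(-sigma)) <= e^sigma sigma, and sigma <= 1. *)
have ex : expR sigma - 1 <= expR 1 * sigma.
  have q1 := expR_ge1Dx (- sigma).
  have q2 : expR sigma * expR (- sigma) = 1 by rewrite expRN divff// gt_eqF ?expR_gt0.
  have q3 : expR sigma <= expR 1 by rewrite ler_expR.
  have q4 := expR_gt0 sigma.
  apply: (@le_trans _ _ (expR sigma * sigma)); last by rewrite ler_wpM2r ?(ltW s0).
  by rewrite -q2 -{1}(mulr1 (expR sigma)) -mulrBr ler_wpM2l ?(ltW q4)//; lra.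
have ex0 : 0 <= expR sigma - 1 by rewrite subr_ge0 -expR0 ler_expR ltW.
have tt : `|t - t0| <= 1 by case: (rho_le1_box h).
have B1 : (S1 + S2) * (expR sigma - 1) <= 3 *+ n * (expR 1 * sigma) by exact: ler_pM.
have B2 : sigma ^+ 2 - 2 * sigma * (t - t0) <= 3 * sigma.
  move: tt; rewrite ler_norml => /andP[tt _]; nra.
have m0 : 0 <= Num.sqrt (4 * pi) ^+ n * sigma `^ (- (1 + s)).
  by rewrite mulr_ge0 ?powR_ge0 ?exprn_ge0.
apply: le_trans (ler_wpM2l m0 (lerD B1 B2)) _.
rewrite opprD powRD; last by rewrite (gt_eqF s0) implybT.
rewrite powR_inv1 ?(ltW s0)//.
rewrite le_eqVlt; apply/orP; left; apply/eqP.
by field; rewrite gt_eqF.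
Qed.

End bump.

(** * Maximum principle *)

Section liouville.
Variable R : realType.
Notation mu := (@lebesgue_measure R).

Lemma max_principle n (s M B k : R) (w : 'rV[R]_n -> R -> R) (h : 'rV[R]_n) :
  0 < s < 1 -> jcont w -> (forall x t, `|w x t| <= M) ->
  (forall N x t, \sum_(i < N) w (x + h *+ i) (t + k *+ i) <= B) ->
  (forall x t, \int[mu]_(sigma in `[d, +oo[) hint s (incr w x t) sigma
     @[d --> 0^'+] --> 0) ->
  forall x t, w x t <= 0.
Proof.
move=> s01 cw wM wB eqn x1 t1; have /andP[s0 s1] := s01.
rewrite leNgt; apply/negP => w1.
pose E := [set r | exists x t, r = w x t].
have supE : has_sup E.
  split; first by exists (w x1 t1), x1, t1.
  by exists M => _ [x [t ->]]; exact: le_trans (ler_norm _) (wM _ _).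
pose A := sup E.
have wA x t : w x t <= A by apply: sup_upper_bound => //; exists x, t.
have A0 : 0 < A by exact: lt_le_trans (wA x1 t1).
(* N A >= B + 2 leaves 2 after subtracting the bound [B] on the sums: one unit pays for N eta <= 1,
   the other is the required lower bound for the sum of [D]. *)
pose N := (Num.truncn ((B + 2) / A)).+1.
have NA : B + 2 <= N%:R * A.
  by rewrite -ler_pdivrMr// ltW// truncnS_gt.
have N0 : 0 < N%:R :> R by rewrite ltr0n.
have [c c0 Hc] := hint_tail_lower k h s0 (isT : 0 < N)%N.
pose m := Num.sqrt (4 * pi) ^+ n : R.
have m0 : 0 <= m by rewrite exprn_ge0.
pose K := (3 *+ n * expR 1 + 3) * m.
have K0 : 0 <= K.
  by rewrite mulr_ge0// addr_ge0// mulr_ge0 ?expR_ge0// mulrn_wge0.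
have s1' : 0 < 1 - s by rewrite subr_gt0.
(* K/(1 - s) is the cost of the bump for lags below 1 and m/s the cost above 1; the extra 1 makes
   [C] visibly positive. *)
pose C := 2 * (K / (1 - s) + m / s + 1).
have C0 : 0 < C.
  by rewrite mulr_gt0// ltr_wpDl// addr_ge0// divr_ge0// ltW.
(* The first bound yields the sum estimate for [D], the second makes the total cost of the bump at
   most c/2; [c] was fixed before [eta]. *)
pose eta := Num.min (N%:R^-1) (c / (2 * C)).
have eta0 : 0 < eta by rewrite lt_min invr_gt0 N0 divr_gt0// mulr_gt0.
have etaN : N%:R * eta <= 1.
  by rewrite -ler_pdivlMl// mulr1 ge_min lexx.
have etaC : eta * C <= c / 2.
  rewrite -ler_pdivlMr// (_ : c / 2 / C = c / (2 * C)) ?ge_min ?lexx ?orbT//.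
  by field; rewrite gt_eqF.
have [_ [x0 [t0 ->]] w0] : exists2 r, E r & A - eta < r by exact: sup_adherent.
have [x [t [rh Wmax]]] := bump_max eta0 cw wA w0.
pose D y r := w x t + 2 * eta * psi x0 t0 x t - (w y r + 2 * eta * psi x0 t0 y r).
have D0 y r : 0 <= D y r by rewrite subr_ge0.
have cD : jcont D.
  move=> x_ x' t_ t' xx tt; apply: cvgB; first exact: cvg_cst.
  apply: cvgD; first exact: cw.
  by apply: cvgM; [exact: cvg_cst|exact: jcont_psi].
have DB y r : `|D y r| <= M + M + 2 * eta.
  rewrite ger0_norm// /D; have := wM x t; have := wM y r.
  rewrite !ler_norml => /andP[a1 _] /andP[_ a2].
  have := psi_le1 x0 t0 x t; have := psi_ge0 x0 t0 y r; nra.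
have wxt : A + eta <= w x t + 2 * eta * psi x0 t0 x t.
  apply: le_trans (Wmax x0 t0).
  have p1 : psi x0 t0 x0 t0 = 1 by rewrite psi_eq rho_center ?subr0 ?ler01.
  by rewrite p1; lra.
have DN y r : 1 <= \sum_(i < N) D (y + h *+ i) (r + k *+ i).
  have Dlow (i : 'I_N) : A - eta - w (y + h *+ i) (r + k *+ i) <= D (y + h *+ i) (r + k *+ i).
    rewrite /D; have := psi_le1 x0 t0 (y + h *+ i) (r + k *+ i); nra.
  apply: le_trans (ler_sum _ (fun i _ => Dlow i)).
  rewrite sumrB sumr_const card_ord -mulr_natl mulrBr.
  by have := wB N y r; lra.
have tail := Hc D (M + M + 2 * eta) x t cD DB D0 DN.
have ciw := jcont_incr (x := x) (t := t) cw.
have biw := incr_bound x t wM.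
have cG : jcont (fun v r => D (x + v) (t - r)).
  move=> v_ v r_ r vv rr; apply: cD; first by apply: tendsD => //; exact: tends_cst.
  by apply: cvgB => //; exact: cvg_cst.
have GB v r : `|D (x + v) (t - r)| <= M + M + 2 * eta by [].
(* The increment of w is D + 2 eta (psi - psi(z)) >= D - 2 eta, as 0 <= psi <= 1. *)
have late sigma : 1 <= sigma ->
    hint s (fun v r => D (x + v) (t - r)) sigma - 2 * eta * m * sigma `^ (- (1 + s))
    <= hint s (incr w x t) sigma.
  move=> sg1; have sg0 : 0 < sigma by exact: lt_le_trans sg1.
  have := @hint_lin _ n s 1 _ _ _ `|- (2 * eta)| sigma sg0 cG
    (@jcont_cst _ n (- (2 * eta))) GB (fun _ _ => lexx _).
  rewrite mul1r hint_cst// -/m => e.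
  rewrite [leLHS](_ : _ = hint s (fun v r => D (x + v) (t - r)) sigma +
    - (2 * eta) * (m * sigma `^ (- (1 + s)))); last by ring.
  rewrite -e; apply: (@hint_le _ _ _ _ _ (M + M + 2 * eta + `|- (2 * eta)|) (M + M)) => //.
  - move=> x_ x' t_ t' xx tt; apply: cvgD; last exact: cvg_cst.
    by apply: cvgM; [exact: cvg_cst|exact: cG].
  - by move=> v r; apply: le_trans (ler_normD _ _) _; rewrite mul1r lerD.
  - move=> v; rewrite mul1r /incr /D.
    have := psi_le1 x0 t0 x t; have := psi_ge0 x0 t0 (x + v) (t - sigma); nra.
(* Here D >= 0 is dropped, and psi - psi(z) >= rho(z) - rho reduces the bound to [rho_heat]. *)
have early sigma : 0 < sigma <= 1 ->
    - (2 * eta * K) * sigma `^ (- s) <= hint s (incr w x t) sigma.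
  move=> sg01; have /andP[sg0 _] := sg01.
  have [nr br] := rho_heat s sg01 rh.
  have [nz ez] := Rn_intZ (- (2 * eta)) (hk_rate_gt0 sg0) nr.
  apply: (@le_trans _ _ (Rn_int (fun v => - (2 * eta) *
     ((rho x0 t0 (x + v) (t - sigma) - rho x0 t0 x t) * hk s sigma v)))).
    by rewrite ez !mulNr lerN2 -[leRHS]mulrA ler_wpM2l ?mulr_ge0 ?(ltW eta0).
  apply: (Rn_int_le (hk_rate_gt0 sg0) nz).
    exact: (@hint_nice _ _ _ _ (M + M)).
  move=> v; rewrite mulrA ler_wpM2r ?hk_ge0// /incr.
  have := Wmax (x + v) (t - sigma); rewrite (psi_eq rh).
  have := psi_ge x0 t0 (x + v) (t - sigma); nra.
have lower d : 0 < d < 1 ->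
    c / 2 <= \int[mu]_(sigma in `[d, +oo[) hint s (incr w x t) sigma.
  move=> /andP[d0 d1].
  have ih : mu.-integrable `[d, +oo[ (EFin \o hint s (incr w x t)) by exact: hint_integrable biw.
  have ih1 : mu.-integrable `[1, +oo[ (EFin \o hint s (incr w x t)) by exact: hint_integrable biw.
  have split_int := Rintegral_itvB ih (_ : (BLeft d <= BRight 1)%O) (_ : (BRight 1 <= +oo)%O).
  have {}split_int : \int[mu]_(sigma in `[d, +oo[) hint s (incr w x t) sigma =
      \int[mu]_(sigma in `[d, 1]) hint s (incr w x t) sigma +
      \int[mu]_(sigma in `[1, +oo[) hint s (incr w x t) sigma.
    rewrite -[X in _ = _ + X]Rintegral_itv_obnd_cbnd; last first.
      by apply: integrableS ih1 => //; apply: subset_itvr; rewrite bnd_simp.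
    rewrite -split_int//; last by rewrite bnd_simp ltW.
    by rewrite addrC subrK.
  have L1 : - (2 * eta * K) / (1 - s) <= \int[mu]_(sigma in `[d, 1]) hint s (incr w x t) sigma.
    have ip : mu.-integrable `[d, 1] (EFin \o (fun x => x `^ (- s))).
      apply: continuous_compact_integrable; first exact: segment_compact.
      apply: continuous_in_subspaceT => y; rewrite inE/= in_itv/= => /andP[dy _].
      by apply: powR_continuous_pos; exact: lt_le_trans dy.
    apply: (@le_trans _ _ (\int[mu]_(y in `[d, 1]) (- (2 * eta * K) * y `^ (- s)))).
      rewrite RintegralZl// !mulNr lerN2 ler_wpM2l ?mulr_ge0 ?(ltW eta0)//.
      by apply: Rintegral_powR_head => //; rewrite d0.
    apply: le_Rintegral => //.
    - apply: continuous_compact_integrable; first exact: segment_compact.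
      apply: continuous_in_subspaceT => y; rewrite inE/= in_itv/= => /andP[dy _].
      apply: cvgM; first exact: cvg_cst.
      by apply: powR_continuous_pos; exact: lt_le_trans dy.
    - by apply: integrableS ih => //; exact: subset_itvl.
    - move=> y; rewrite /= in_itv/= => /andP[dy y1]; apply: early.
      by rewrite y1 andbT (lt_le_trans d0).
  have L2 : c - 2 * eta * m / s <= \int[mu]_(sigma in `[1, +oo[) hint s (incr w x t) sigma.
    have iD : mu.-integrable `[1, +oo[ (EFin \o hint s (fun v r => D (x + v) (t - r))).
      exact: hint_integrable GB.
    have ip := integrable_powR_tail s0 (ltr01 : 0 < 1 :> R).
    have ipc : mu.-integrable `[1, +oo[ (EFin \o (fun x : R => 2 * eta * m * x `^ (- (1 + s)))).
      rewrite (_ : EFin \o _ = (fun x : R => (2 * eta * m)%:E *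
         (EFin \o (fun x : R => x `^ (- (1 + s)))%R) x)%E).
        exact: integrableZl.
      by apply/funext => y /=; rewrite EFinM.
    apply: (@le_trans _ _ (\int[mu]_(y in `[1, +oo[)
        (hint s (fun v r => D (x + v) (t - r)) y - 2 * eta * m * y `^ (- (1 + s))))).
      rewrite RintegralB// RintegralZl// Rintegral_powR_tail// powR1 mul1r.
      by rewrite lerD2r.
    apply: le_Rintegral => //.
    - exact: (integrableB _ iD ipc).
    - by move=> y; rewrite /= in_itv/= andbT => /late.
  rewrite split_int; apply: le_trans (lerD L1 L2).
  have -> : - (2 * eta * K) / (1 - s) + (c - 2 * eta * m / s) =
      c - eta * (2 * (K / (1 - s) + m / s)) by field; rewrite !gt_eqF.
  have : eta * (2 * (K / (1 - s) + m / s)) <= eta * C.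
    by rewrite ler_wpM2l ?(ltW eta0)// /C; lra.
  lra.
(* The lower bound is uniform in the cut-off [d], so it survives the limit, which the equation says
   is 0. *)
have : c / 2 <= 0.
  apply: (cvgr_to_ge (eqn x t)); near=> d.
  by apply: lower; apply/andP; split => //; near: d; exact: nbhs_right_lt.
by rewrite leNgt divr_gt0.
Unshelve. all: by end_near. Qed.

Lemma liouville_le n (s M k : R) (u : 'rV[R]_n.+1 -> R -> R) (h : 'rV[R]_n.+1) :
  0 < s < 1 -> jcont u -> (forall x t, `|u x t| <= M) ->
  (forall x t, frac_heat_value s u x t 0) ->
  forall x t, u (x + h) (t + k) <= u x t.
Proof.
move=> s01 cu uM sol x t; have /andP[s0 _] := s01.
pose w y r := u (y + h) (r + k) - u y r.
suff : w x t <= 0 by rewrite subr_le0.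
have cw : jcont w.
  move=> x_ y t_ r xx tt; apply: cvgB; last exact: cu.
  apply: cu; first by apply: tendsD => //; exact: tends_cst.
  by apply: cvgD => //; exact: cvg_cst.
apply: (@max_principle _ s (M + M) (M + M) k w h) => //.
- by move=> y r; apply: le_trans (ler_normB _ _) _; exact: lerD.
- move=> N y r.
  have -> : \sum_(i < N) w (y + h *+ i) (r + k *+ i) = u (y + h *+ N) (r + k *+ N) - u y r.
    elim: N => [|N IH]; first by rewrite big_ord0 !mulr0n !addr0 subrr.
    by rewrite big_ord_recr/= IH /w -[y + _ + h]addrA -[r + _ + k]addrA -!mulrSr; ring.
  by apply: le_trans (ler_norm _) _; apply: le_trans (ler_normB _ _) _; exact: lerD.
- move=> y r.
  (* The two equations are subtracted at each cut-off [d], where both integrals are absolutely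
     convergent, and only then is the limit taken. *)
  have c : (\int[mu]_(sg in `[d, +oo[) hint s (incr u (y + h) (r + k)) sg -
      \int[mu]_(sg in `[d, +oo[) hint s (incr u y r) sg) @[d --> 0^'+] --> 0 - 0.
    by apply: cvgB; exact: frac_heat_value_hint s01 cu uM (sol _ _).
  rewrite subr0 in c; apply: cvg_trans c; apply: near_eq_cvg; near=> d.
  have d0 : 0 < d by [].
  rewrite /= -RintegralB//; last 2 first.
  + exact: (hint_integrable s0 d0 (jcont_incr cu) (incr_bound _ _ uM)).
  + exact: (hint_integrable s0 d0 (jcont_incr cu) (incr_bound _ _ uM)).
  apply: eq_Rintegral => sg; rewrite inE => /(itvcy_pos d0); rewrite /= in_itv/= andbT => sg0.
  have := @hint_lin _ _ s (-1) _ _ _ _ sg sg0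
    (@jcont_incr _ _ _ y r cu) (@jcont_incr _ _ _ (y + h) (r + k) cu)
    (incr_bound _ _ uM) (incr_bound _ _ uM).
  rewrite mulN1r [RHS]addrC => <-; apply: eq_Rn_int => v; congr (_ * _).
  rewrite /incr /w mulN1r !opprB.
  rewrite [y + h + v]addrAC [r + k - sg]addrAC; ring.
Unshelve. all: by end_near. Qed.

(** The inequality for the shift from the origin to (x, t) and for the opposite shift. *)
Lemma liouville_cst n (s M : R) (u : 'rV[R]_n.+1 -> R -> R) :
  0 < s < 1 -> jcont u -> (forall x t, `|u x t| <= M) ->
  (forall x t, frac_heat_value s u x t 0) ->
  forall x t, u x t = u 0 0.
Proof.
move=> s01 cu uM sol x t; apply/eqP; rewrite eq_le; apply/andP; split.
  by have := liouville_le t x s01 cu uM sol 0 0; rewrite !add0r.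
by have := liouville_le (- t) (- x) s01 cu uM sol x t; rewrite !subrr.
Qed.

End liouville.

(** * Joint continuity from parabolic regularity *)

Section regularity.
Variable R : realType.

Lemma mvt_le (phi : R -> R) (c a K : R) :
  (forall r, derivable phi r 1) ->
  (forall r, `|r - c| <= `|a| -> `|derive1 phi r| <= K) ->
  `|phi (c + a) - phi c| <= K * `|a|.
Proof.
move=> dphi bK.
have isd (r : R) : is_derive r 1 phi (derive1 phi r).
  by rewrite derive1E; exact/derivableP.
have cphi (A : set R) : {within A, continuous phi}.
  by apply: continuous_subspaceT => r; apply: differentiable_continuous; exact/derivable1_diffP.
case: (leP 0 a) => a0.
  have [|xi] := @MVT_segment _ phi (derive1 phi) c (c + a) _ (fun r _ => isd r) (cphi _).
    by rewrite lerDl.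
  rewrite in_itv/= => /andP[x1 x2] ->; rewrite addrC addKr normrM ler_wpM2r// bK//.
  by rewrite !ger0_norm// ?subr_ge0//; lra.
have [|xi] := @MVT_segment _ phi (derive1 phi) (c + a) c _ (fun r _ => isd r) (cphi _).
  by rewrite gerDl ltW.
rewrite in_itv/= => /andP[x1 x2] e; rewrite distrC e.
rewrite opprD addrA subrr sub0r normrM normrN ler_wpM2r// bK//.
by rewrite (ltr0_norm a0) ler_norml; lra.
Qed.

Lemma line_derive n (g : 'rV[R]_n -> R) (z e : 'rV[R]_n) (r : R) :
  derivable g (z + r *: e) e ->
  derivable (fun q : R => g (z + q *: e)) r 1 /\
  derive1 (fun q : R => g (z + q *: e)) r = 'D_e g (z + r *: e).
Proof.
move=> dg.
have E : (fun h : R => h^-1 *: (((fun q : R => g (z + q *: e)) \o shift r) (h *: 1) -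
      g (z + r *: e))) =
    (fun h => h^-1 *: ((g \o shift (z + r *: e)) (h *: e) - g (z + r *: e))).
  apply/funext => h /=; congr (_ *: (g _ - _)).
  by rewrite [h *: 1]mulr1 scalerDl addrCA.
by rewrite derive1E /derivable /derive E.
Qed.

Lemma mvt_line n (g : 'rV[R]_n -> R) (z e : 'rV[R]_n) (a K : R) :
  (forall y, derivable g y e) ->
  (forall r, `|r| <= `|a| -> `|'D_e g (z + r *: e)| <= K) ->
  `|g (z + a *: e) - g z| <= K * `|a|.
Proof.
move=> dg bK.
have := @mvt_le (fun q : R => g (z + q *: e)) 0 a K.
rewrite add0r scale0r addr0; apply => r.
  by case: (line_derive (dg (z + r *: e))).
rewrite subr0 => ra; case: (line_derive (dg (z + r *: e))) => _ ->.
exact: bK.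
Qed.

(** Coordinates are switched from x to y one at a time. The path stays in the box around x, and each
    move uses a single partial derivative, so no total differentiability is involved. *)
Lemma mvt_coords n (g : 'rV[R]_n -> R) (x y : 'rV[R]_n) (d K : R) :
  (forall i z, derivable g z (delta_mx 0 i)) ->
  (forall i (z : 'rV[R]_n), (forall j, `|z 0 j - x 0 j| <= d) -> `|'D_(delta_mx 0 i) g z| <= K) ->
  (forall j, `|y 0 j - x 0 j| <= d) ->
  `|g y - g x| <= K * \sum_i `|y 0 i - x 0 i|.
Proof.
move=> dg bK yx.
pose z m : 'rV[R]_n := \row_j (if (j < m)%N then y 0 j else x 0 j).
have z0 : z 0%N = x by apply/rowP => j; rewrite mxE.
have zn : z n = y by apply/rowP => j; rewrite mxE ltn_ord.
have step (m : 'I_n) : `|g (z m.+1) - g (z m)| <= K * `|y 0 m - x 0 m|.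
  have -> : z m.+1 = z m + (y 0 m - x 0 m) *: delta_mx 0 m.
    apply/rowP => j; rewrite !mxE eqxx/= ltnS leq_eqVlt.
    case: (eqVneq j m) => [->|jm]; first by rewrite eqxx ltnn/= mulr1 addrC subrK.
    have -> : (j == m :> nat) = false by apply/negbTE.
    by rewrite /= mulr0 addr0.
  apply: mvt_line => // r rm; apply: bK => j.
  rewrite !mxE eqxx/=; case: (eqVneq j m) => [->|jm].
    by rewrite ltnn mulr1 [_ + r]addrC addrK (le_trans rm).
  by rewrite mulr0 addr0; case: ifP => // _; rewrite subrr normr0 (le_trans _ (yx j)).
have tele m : (m <= n)%N -> g (z m) - g (z 0%N) = \sum_(0 <= i < m) (g (z i.+1) - g (z i)).
  by move=> mn; rewrite telescope_sumr.
rewrite -{1}zn -{1}z0 tele// big_mkord.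
apply: le_trans (ler_norm_sum _ _ _) _; rewrite mulr_sumr.
by apply: ler_sum => i _; exact: step.
Qed.

Lemma jcont_bounded n (f : 'rV[R]_n -> R -> R) (x : 'rV[R]_n) (t : R) :
  jcont f -> exists2 d : R, 0 < d & exists K : R, forall (y : 'rV[R]_n) (r : R),
    (forall j, `|y 0 j - x 0 j| <= d) -> `|r - t| <= d -> `|f y r| <= K.
Proof.
move=> cf; have /(_ (x, t))/cvgrPdist_le/(_ 1 ltr01)/= := jcont_continuous cf.
move=> [[A B] /= [/nbhs_ballP[a/= a0 xa] /nbhs_ballP[b/= b0 tb]] HAB].
pose m := Num.min a b / 2.
have mab : 0 < Num.min a b by rewrite lt_min a0.
exists m; first by rewrite divr_gt0.
have mlt : m < Num.min a b by rewrite /m; lra.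
exists (1 + `|f x t|) => y r yx rt.
have := HAB (y, r); rewrite /= => H.
have : `|f x t - f y r| <= 1.
  apply: H; split => /=.
    apply: xa; split => // i j; rewrite ord1 /ball/=.
    by rewrite distrC (le_lt_trans (yx j))// (lt_le_trans mlt)// ge_min lexx.
  by apply: tb; rewrite /ball/= distrC (le_lt_trans rt)// (lt_le_trans mlt)// ge_min lexx orbT.
move=> h; rewrite -[f y r](subKr (f x t)).
by apply: le_trans (ler_normB _ _) _; rewrite addrC lerD2r.
Qed.

Lemma enorm_cvg0 n (x_ : nat -> 'rV[R]_n) x : tends x_ x ->
  enorm (x_ k - x) @[k --> \oo] --> 0.
Proof.
move=> xx; have := cvg_enorm (tendsD xx (@tends_cst _ _ (- x))).
suff -> : enorm (x - x) = 0 by [].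
by rewrite /enorm /sqnorm big1 ?sqrtr0// => i _; rewrite subrr mxE expr0n.
Qed.

Lemma tends_near n (x_ : nat -> 'rV[R]_n) (x : 'rV[R]_n) (d : R) : 0 < d -> tends x_ x ->
  \forall k \near \oo, forall j, `|x_ k 0 j - x 0 j| <= d.
Proof.
move=> d0 xx.
have H : \forall k \near \oo, enorm (x_ k - x) < d by exact: (cvgr_lt _ (enorm_cvg0 xx)).
apply: filterS H => k kd j.
apply: le_trans (ltW kd); rewrite /enorm -sqrtr_sqr ler_wsqrtr//.
rewrite /sqnorm (bigD1 j)//= !mxE lerDl sumr_ge0// => i _; exact: sqr_ge0.
Qed.

(** Continuous partial derivatives are locally bounded, so [mvt_coords] gives a local Lipschitz
    bound. *)
Lemma seqcont_partials n (g : 'rV[R]_n -> R) :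
  (forall i z, derivable g z (delta_mx 0 i)) ->
  (forall i, seqcont (fun z => 'D_(delta_mx 0 i) g z)) -> seqcont g.
Proof.
move=> dg cd x_ x xx.
(* A dummy time variable lets [jcont_bounded] apply to a function of space alone. *)
have cj i : jcont (fun z (_ : R) => 'D_(delta_mx 0 i) g z).
  by move=> y_ y t_ t yy _; exact: cd.
have [d d0 [K HK]] : exists2 d : R, 0 < d & exists K : R, forall i (z : 'rV[R]_n),
    (forall j, `|z 0 j - x 0 j| <= d) -> `|'D_(delta_mx 0 i) g z| <= K.
  have H i : exists p : R * R, 0 < p.1 /\ forall z : 'rV[R]_n,
      (forall j, `|z 0 j - x 0 j| <= p.1) -> `|'D_(delta_mx 0 i) g z| <= p.2.
    have [d d0 [K HK]] := jcont_bounded x 0 (cj i).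
    exists (d, K); split => // z zx; apply: (HK z 0) => //.
    by rewrite subrr normr0 ltW.
  have [p Hp] := choice H.
  exists (\big[Num.min/1]_i (p i).1).
    by apply/bigmin_gtP; split => // i _; case: (Hp i).
  exists (\sum_i `|(p i).2|) => i z zx.
  have [_ /(_ z)] := Hp i => H1.
  apply: le_trans (H1 _) _.
    by move=> j; apply: le_trans (zx j) _; exact: bigmin_le_cond.
  apply: le_trans (ler_norm _) _.
  by rewrite (bigD1 i)//= lerDl sumr_ge0.
have c0 : K * \sum_i `|x_ k 0 i - x 0 i| @[k --> \oo] --> 0.
  rewrite -[X in _ --> X](mulr0 K); apply: cvgM; first exact: cvg_cst.
  rewrite [X in _ --> X](_ : _ = \sum_(i < n) (0 : R)); last by rewrite big1.
  apply: cvg_sum_ord => i; rewrite -[X in _ --> X](normr0 R).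
  apply: cvg_norm; rewrite -(subrr (x 0 i)); apply: cvgB (xx i) (cvg_cst _).
apply/cvgrPdist_le => e e0; near=> k.
rewrite distrC; apply: le_trans (mvt_coords dg HK _) _.
  by near: k; exact: tends_near.
by near: k; apply: (cvgr_le _ c0).
Unshelve. all: by end_near. Qed.

Lemma powR_cvg_zero (y_ : nat -> R) (p : R) : 0 < p -> (forall k, 0 <= y_ k) ->
  y_ k @[k --> \oo] --> 0 -> (y_ k) `^ p @[k --> \oo] --> 0.
Proof.
move=> p0 yge yy; apply/cvgrPdist_le => e e0.
have q0 : 0 < e `^ (p^-1) by exact: powR_gt0.
near=> k.
have yq : y_ k <= e `^ p^-1 by near: k; apply: (cvgr_le _ yy).
rewrite sub0r normrN ger0_norm ?powR_ge0//.
have -> : e = (e `^ p^-1) `^ p by rewrite -powRrM mulVf ?gt_eqF// powRr1// ltW.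
by apply: ge0_ler_powR; rewrite ?nnegrE ?(ltW p0) ?(ltW q0).
Unshelve. all: by end_near. Qed.

Lemma mx_norm_le_enorm n (v : 'rV[R]_n) : `|v| <= enorm v.
Proof.
rewrite /Num.norm/= mx_normrE; apply/bigmax_leP; split; first exact: sqrtr_ge0.
move=> [i j] _ /=; rewrite ord1 /enorm -sqrtr_sqr ler_wsqrtr//.
rewrite /sqnorm (bigD1 j)//= lerDl sumr_ge0// => k _; exact: sqr_ge0.
Qed.

Lemma in_box_near n (x_ : nat -> 'rV[R]_n) (x : 'rV[R]_n) (t_ : nat -> R) (t : R) : tends x_ x ->
  t_ k @[k --> \oo] --> t ->
  \forall k \near \oo, in_box (`|x| + `|t| + 1) (x_ k) (t_ k).
Proof.
move=> xx tt; near=> k; split.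
  rewrite -[x_ k](subrK x); apply: le_trans (ler_normD _ _) _.
  rewrite [leRHS](_ : _ = 1 + `|t| + `|x|); last by ring.
  rewrite lerD2r; apply: le_trans (mx_norm_le_enorm _) _.
  apply: (@le_trans _ _ 1); last by rewrite lerDl.
  by near: k; apply: (cvgr_le _ (enorm_cvg0 xx)).
rewrite -[t_ k](subrK t); apply: le_trans (ler_normD _ _) _.
rewrite [leRHS](_ : _ = 1 + `|x| + `|t|); last by ring.
rewrite lerD2r; apply: (@le_trans _ _ 1); last by rewrite lerDl.
by rewrite distrC; near: k; move/cvgrPdist_le: tt; apply.
Unshelve. all: by end_near. Qed.

Lemma cvg_of_bound (f_ : nat -> R) (l C : R) (b_ : nat -> R) :
  (\forall k \near \oo, `|f_ k - l| <= C * b_ k) ->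
  b_ k @[k --> \oo] --> 0 -> f_ k @[k --> \oo] --> l.
Proof.
move=> fb b0; have c0 : C * b_ k @[k --> \oo] --> 0.
  by rewrite -[X in _ --> X](mulr0 C); apply: cvgM b0; exact: cvg_cst.
apply/cvgrPdist_le => e e0; near=> k; rewrite distrC.
apply: (@le_trans _ _ (C * b_ k)); first by near: k.
by near: k; apply: (cvgr_le _ c0).
Unshelve. all: by end_near. Qed.

(** The time increment is taken at the moving point [x_ k], so some uniformity in space is needed
    there; Hoelder continuity in time or a locally bounded time derivative provides it. *)
Lemma jcont_of_slices n (f : 'rV[R]_n -> R -> R) :
  (forall t, seqcont (fun y => f y t)) ->
  (forall x_ x t_ t, tends x_ x -> t_ k @[k --> \oo] --> t ->
    f (x_ k) (t_ k) - f (x_ k) t @[k --> \oo] --> 0) -> jcont f.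
Proof.
move=> fx ft x_ x t_ t xx tt.
have c : (f (x_ k) (t_ k) - f (x_ k) t) + f (x_ k) t @[k --> \oo] --> 0 + f x t.
  by apply: cvgD; [exact: ft xx tt|exact: fx].
rewrite add0r in c; apply: cvg_trans c; apply: near_eq_cvg.
by apply: nearW => k; rewrite subrK.
Qed.

Lemma holder_low_jcont n (alpha : R) (f : 'rV[R]_n -> R -> R) : 0 < alpha ->
  holder_low alpha f -> jcont f.
Proof.
move=> a0 hf x_ x t_ t xx tt.
have [C HC] := hf (`|x| + `|t| + 1).
apply: (@cvg_of_bound _ _ C (fun k => (enorm (x_ k - x) + `|t_ k - t| `^ (1 / 2)) `^ (2 * alpha))).
  have := in_box_near xx tt; apply: filterS => k bk; apply: HC => //.
  by split; [have := normr_ge0 t|have := normr_ge0 x]; lra.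
apply: powR_cvg_zero; first by rewrite mulr_gt0.
  by move=> k; rewrite addr_ge0 ?powR_ge0// sqrtr_ge0.
rewrite -[X in _ --> X](addr0 0); apply: cvgD; first exact: enorm_cvg0.
apply: powR_cvg_zero => //.
by rewrite -[X in _ --> X](normr0 R) -(subrr t); apply: cvg_norm; apply: cvgB tt (cvg_cst _).
Qed.

Lemma holder_t_cvg n (beta : R) (f : 'rV[R]_n -> R -> R)
    (x_ : nat -> 'rV[R]_n) (x : 'rV[R]_n) (t_ : nat -> R) (t : R) : 0 < beta ->
  holder_t beta f -> tends x_ x -> t_ k @[k --> \oo] --> t ->
  f (x_ k) (t_ k) - f (x_ k) t @[k --> \oo] --> 0.
Proof.
move=> b0 hf xx tt; have [C HC] := hf (`|x| + `|t| + 1).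
apply: (@cvg_of_bound _ _ C (fun k => `|t_ k - t| `^ beta)).
  have := in_box_near xx tt; apply: filterS => k bk; rewrite subr0; apply: HC => //.
  by split; [case: bk|have := normr_ge0 x; lra].
apply: powR_cvg_zero => //.
by rewrite -[X in _ --> X](normr0 R) -(subrr t); apply: cvg_norm; apply: cvgB tt (cvg_cst _).
Qed.

Lemma holder_x_seqcont n (beta : R) (f : 'rV[R]_n -> R -> R) (t : R) : 0 < beta ->
  holder_x beta f -> seqcont (fun y => f y t).
Proof.
move=> b0 hf x_ x xx; have [C HC] := hf (`|x| + `|t| + 1).
apply: (@cvg_of_bound _ _ C (fun k => enorm (x_ k - x) `^ beta)).
  have H : \forall k \near \oo, in_box (`|x| + `|t| + 1) (x_ k) t.
    by apply: (in_box_near (t_ := fun=> t)) => //; exact: cvg_cst.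
  apply: filterS H => k bk; apply: HC => //.
  by split; [have := normr_ge0 t|have := normr_ge0 x]; lra.
apply: powR_cvg_zero => //; last exact: enorm_cvg0.
by move=> k; exact: sqrtr_ge0.
Qed.

Lemma dt_bounded_cvg n (f : 'rV[R]_n -> R -> R)
    (x_ : nat -> 'rV[R]_n) (x : 'rV[R]_n) (t_ : nat -> R) (t : R) :
  (forall x t, derivable (f x) t 1) -> jcont (dt f) ->
  tends x_ x -> t_ k @[k --> \oo] --> t ->
  f (x_ k) (t_ k) - f (x_ k) t @[k --> \oo] --> 0.
Proof.
move=> df cf xx tt; have [d d0 [K HK]] := jcont_bounded x t cf.
have ct : `|t_ k - t| @[k --> \oo] --> 0.
  by rewrite -(normr0 R) -(subrr t); apply: cvg_norm; apply: cvgB tt (cvg_cst _).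
apply: (@cvg_of_bound _ _ K (fun k => `|t_ k - t|)) => //.
near=> k; rewrite subr0.
have := @mvt_le (f (x_ k)) t (t_ k - t) K (df _).
rewrite [t + _]addrC subrK; apply => r rk; apply: HK.
  by near: k; exact: tends_near.
by apply: le_trans rk _; near: k; apply: (cvgr_le _ ct).
Unshelve. all: by end_near. Qed.

(** In the middle range, alpha > 1/2 makes the exponent 2 alpha - 1 of the gradient positive, so the
    gradient is continuous in space. In the recursive case the induction hypothesis makes the second
    derivatives continuous, and [seqcont_partials] is applied twice to descend to [f]. *)
Lemma par_holder_jcont k n (alpha : R) (f : 'rV[R]_n -> R -> R) :
  par_holder k alpha f -> jcont f.
Proof.
elim: k alpha f => [|k IH] alpha f /=.
  case=> [[/andP[a0 _] hf]|[/andP[a0 _] [ht [df hd]]]]; first exact: holder_low_jcont hf.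
  apply: jcont_of_slices => [t|x_ x t_ t]; last by apply: holder_t_cvg ht; lra.
  apply: seqcont_partials => [i z|i]; first exact: df.
  by have [hx _] := hd i; apply: holder_x_seqcont hx; lra.
move=> [_ [dtf [dxf [ddf [ct cx]]]]].
apply: jcont_of_slices => [t|x_ x t_ t]; last exact: dt_bounded_cvg dtf (IH _ _ ct).
apply: seqcont_partials => [i z|i]; first exact: dxf.
apply: seqcont_partials => [j z|j]; first exact: ddf.
exact: (jcont_slice (IH _ _ (cx i j))).
Qed.

End regularity.

Theorem theorem1p4 (R : realType) (n : nat) (s : R) (u : 'rV[R]_n -> R -> R) :
  (1 <= n)%N -> 0 < s < 1 ->
  (exists eps : R, 0 < eps /\ parabolic_holder_loc (s + eps) u) ->
  (exists M : R, forall x t, `|u x t| <= M) ->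
  (forall x t, frac_heat_value s u x t 0) ->
  exists c : R, forall x t, u x t = c.
Proof.
case: n u => [//|n] u _ s01 [eps [_ [k hu]]] [M uM] sol; exists (u 0 0).
exact: liouville_cst s01 (par_holder_jcont hu) uM sol.
Qed.
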